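(* Let $(X,d,\mu)$ be an $(\alpha,\beta)$-regular metric measure space, where $\alpha,\beta>0$. Let $Q\subset X$ be a WDS subset of $X$ with radius function $R:Q\to\mathbb{R}_+$. Let $\psi:(0,\infty)\to(0,\infty)$ be a non-decreasing function such that the series $\sum_{\xi\in Q}\left(\frac{\psi(R(\xi))}{R(\xi)}\right)^{\alpha}$ converges. Then $$\dim E_{\psi}(Q,R)=\dim W_{\psi}(Q,R)=\frac{\alpha}{\underline{\lambda}(\psi)},$$ where $\dim$ denotes Hausdorff dimension.
   Context: A Borel measure $\mu$ on a metric space $(X,d)$ is $(\alpha,\beta)$-regular ($\alpha,\beta>0$) if there is $C>0$ such that for every ball $B=B(\xi,r)\subset X$ and every annulus $A(\xi,r,R):=\overline{B}(\xi,R)\setminus B(\xi,r)$ with $0\le r\le R\le \mathrm{diam}(X)$: (1) (Ahlfors regularity) $r^\alpha/C\le\mu(B)\le C r^\alpha$; (2) (annular regularity) $\frac1C r^\alpha\left(\frac{R-r}{r}\right)^\beta\le \mu(A(\xi,r,R))$. The space is $\alpha$-Ahlfors regular if (1) holds. For an $\alpha$-Ahlfors regular metric measure space $(X,d,\mu)$, a countable subset $Q\subset X$ is WDS with radius function $R:Q\to\mathbb{R}_+$ if there exists a constant $C\ge1$ such that: (1) (well-separated) for all $\xi,\zeta\in Q$, $d(\xi,\zeta)\ge \frac1C\min\{R(\xi),R(\zeta)\}$; (2) (well-distributed) for each ball $B=B(\eta,r)\subset X$ there is $k_B\in\mathbb{N}$ such that for each $k\ge k_B$ there is a subset $Q_B(k)\subset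 Q$ with (a) $1/(Ck)\le R(\xi)\le C/k$ for all $\xi\in Q_B(k)$, (b) $\bigcup_{\xi\in Q_B(k)}B(\xi,R(\xi))\subset B$, (c) $\#Q_B(k)\ge \frac1C k^\alpha\mu(B)$. For a countable $Q\subset X$, $R:Q\to\mathbb{R}_+$ and $\psi$, define $W_\psi(Q,R):=\{x\in X: d(x,\xi)<\psi(R(\xi))\text{ for infinitely many }\xi\in Q\}$ and $E_\psi(Q,R):=W_\psi(Q,R)\setminus\bigcup_{0<c<1}W_{c\psi}(Q,R)$. The lower order at zero of $\psi$ is $\underline{\lambda}(\psi):=\liminf_{x\to0}\frac{\log\psi(x)}{\log x}$.
   Formalization: The formal theorem additionally assumes that X is complete, that μ(X)>0, and that the radius function R is bounded on Q (automatic when X is bounded); without each of these the statement as written has counterexamples. *)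

(* Defs.v *)
From HB Require Import structures.
From mathcomp Require Import all_boot all_order all_algebra.
From mathcomp Require Import all_classical all_reals all_analysis.

Set Implicit Arguments.
Unset Strict Implicit.
Unset Printing Implicit Defensive.

Import Order.TTheory GRing.Theory Num.Theory.
Import numFieldNormedType.Exports.

Local Open Scope classical_set_scope.
Local Open Scope ring_scope.

#[short(type="completeMetricType")]
HB.structure Definition CompleteMetric (K : numDomainType) :=
  {M of Metric K M & Complete M}.

Section hausdorff_dimension.
Context {R : realType} {X : metricType R}.
Implicit Types (A : set X) (s delta : R).
Local Open Scope ereal_scope.

(* The added 0 makes diam set0 = 0 (ereal_sup set0 is -oo). *)
Definition diam A : \bar R :=
  ereal_sup (0 |` [set (mdist p.1 p.2)%:E | p in A `*` A]).

Definition hausdorff_premeasure s delta A : \bar R :=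
  ereal_inf [set \sum_(0 <= i <oo) diam (U i) `^ s | U in
    [set U : (set X)^nat | A `<=` \bigcup_i U i /\
                           forall i, diam (U i) <= delta%:E]].

Definition hausdorff_measure s A : \bar R :=
  ereal_sup [set hausdorff_premeasure s delta A | delta in
    [set delta | (0 < delta)%R]].

(* Restricting to s > 0 does not change the infimum, and avoids the case
   s = 0, where the empty sets padding a cover would count as 0 `^ 0 = 1. *)
Definition hausdorff_dim A : \bar R :=
  ereal_inf [set s%:E | s in
    [set s | (0 < s)%R /\ hausdorff_measure s A = 0]].

End hausdorff_dimension.

Section regular_spaces.
Context {R : realType} {X : completeMetricType R}.
Local Notation borelX := (g_sigma_algebraType (@open X)).
Implicit Types (mu : {measure set borelX -> \bar R}) (alpha beta C : R).

(* In a general metric space this may be larger than the closure of the open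
   ball, which is what the library calls closed_ball. *)
Definition cball (x : X) (r : R) : set X := [set y | mdist x y <= r].

Definition annulus (x : X) (r1 r2 : R) : set X := cball x r2 `\` ball x r1.

Definition ahlfors_bounds mu alpha C : Prop :=
  forall (x : X) (r : R), 0 <= r -> (r%:E <= diam [set: X])%E ->
    ((r `^ alpha / C)%:E <= mu (ball x r : set X) <= (C * r `^ alpha)%:E)%E.

(* The lower bound is undefined at r1 = 0, hence the strict inequality. *)
Definition annular_bounds mu alpha beta C : Prop :=
  forall (x : X) (r1 r2 : R), 0 < r1 -> r1 <= r2 ->
    (r2%:E <= diam [set: X])%E ->
    ((C^-1 * r1 `^ alpha * ((r2 - r1) / r1) `^ beta)%:E
       <= mu (annulus x r1 r2))%E.

Definition ab_regular mu alpha beta : Prop :=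
  exists C, [/\ 0 < C, ahlfors_bounds mu alpha C &
                annular_bounds mu alpha beta C].

(* Only the values of rad on Q are meaningful. *)
Definition well_separated (Q : set X) (rad : X -> R) C : Prop :=
  forall xi zeta, Q xi -> Q zeta -> xi <> zeta ->
    C^-1 * Num.min (rad xi) (rad zeta) <= mdist xi zeta.

Definition well_distributed mu alpha (Q : set X) (rad : X -> R) C : Prop :=
  forall (eta : X) (r : R), 0 < r ->
  exists k_B : nat, forall k : nat, (k_B <= k)%N ->
  exists QBk : set X,
    [/\ QBk `<=` Q,
        forall xi, QBk xi -> (C * k%:R)^-1 <= rad xi <= C / k%:R,
        \bigcup_(xi in QBk) ball xi (rad xi) `<=` ball eta r &
        ((C^-1 * k%:R `^ alpha)%:E * mu (ball eta r : set X)
           <= counting QBk)%E].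

Definition WDS mu alpha (Q : set X) (rad : X -> R) : Prop :=
  exists C, [/\ 1 <= C, well_separated Q rad C &
                well_distributed mu alpha Q rad C].

End regular_spaces.

Section approximation.
Context {R : realType} {X : metricType R}.
Implicit Types (Q : set X) (rad : X -> R) (psi : R -> R).

Definition Wset psi Q rad : set X :=
  [set x | infinite_set [set xi | Q xi /\ mdist x xi < psi (rad xi)]].

Definition Eset psi Q rad : set X :=
  Wset psi Q rad `\`
  \bigcup_(c in [set c : R | 0 < c < 1]) Wset (fun t => c * psi t) Q rad.

Definition lower_order psi : \bar R :=
  limf_einf (fun x : R => (ln (psi x) / ln x)%:E) 0^'+.

End approximation.

(* Main.v *)
(** Upper bound. Near 0, [psi t <= t `^ a] for every [a] below the lower order,
    and by separation a small ball contains [O(r `^ (- alpha))] points of [Q] with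
    radius about [r]. Hence the balls [B(xi, psi (rad xi))] with [rad xi] small
    enough (depending on the location) cover [W] with an arbitrarily small
    [s]-dimensional sum as soon as [s * a > alpha].

    Lower bound. No measure is put on a Cantor subset of [E]. Instead, given
    sets [U i] whose [s]-dimensional sum is small, a single nested sequence of
    balls is built whose limit lies in [E] and avoids every [U i]. A ball of
    radius [rho] of the sequence meets only sets [U i] with total weight at most
    [kappa * rho `^ s]. The next ball lies in [B(xi, psi (rad xi))], away from
    its center by almost [psi (rad xi)], where [xi] is one of the [~ k `^ alpha]
    points of scale [1/k] provided by well-distribution. A packing count shows
    that, for suitable [k], fewer points than that are spoiled: those too close
    to another [zeta] of [Q] are few because the series converges, and those
    near a heavy part of the cover are few because [psi] is at least
    [t `^ b], [s * b < alpha], at arbitrarily small [t]. *)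

Require Import Defs.
From mathcomp Require Import all_boot all_order all_algebra.
From mathcomp Require Import ring lra finmap.
From mathcomp Require Import all_classical all_reals all_analysis.

Set Implicit Arguments.
Unset Strict Implicit.
Unset Printing Implicit Defensive.

Import Order.TTheory GRing.Theory Num.Theory.
Import numFieldNormedType.Exports.

Local Open Scope classical_set_scope.
Local Open Scope ring_scope.

(** * Unordered sums *)

Section esum_complements.
Context {R : realType}.
Local Open Scope ereal_scope.

Lemma le_esum_set (T : choiceType) (A B : set T) (f : T -> \bar R) :
  A `<=` B -> \esum_(i in A) f i <= \esum_(i in B) f i.
Proof.
move=> AB; apply: le_ereal_sup => _ [X [finX XA] <-].
by exists X => //; split => // x /XA/AB.
Qed.

Lemma esumZl_le (T : choiceType) (A : set T) (f : T -> \bar R) (c : R) :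
  (0 <= c)%R -> (forall i, 0 <= f i) ->
  \esum_(i in A) (c%:E * f i) <= c%:E * \esum_(i in A) f i.
Proof.
move=> c0 f0; apply: ge_ereal_sup => _ [X [finX XA] <-].
rewrite -ge0_mule_fsumr//; apply: lee_wpmul2l => //; apply: esum_ge.
by exists X.
Qed.

Lemma exchange_esum (T1 T2 : choiceType) (A : set T1) (B : set T2)
    (f : T1 -> T2 -> \bar R) : (forall i j, A i -> B j -> 0 <= f i j) ->
  \esum_(i in A) \esum_(j in B) f i j = \esum_(j in B) \esum_(i in A) f i j.
Proof.
move=> f0; rewrite !esum_esum//; last by move=> i j Bi Aj; exact: f0.
rewrite (reindex_esum (B `*` A) _ (fun x => (x.2, x.1)))//; split=> //=.
- by move=> [i j] [/=].
- by move=> [i1 i2] [j1 j2] /= _ _ [] -> ->.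
- by move=> [i1 i2] [Ai1 Bi2] /=; exists (i2, i1).
Qed.

(** Each point of the union is charged to one chosen index [g x] whose set contains it; [x] mapped
    to [(g x, x)] embeds the union into the disjoint sum of the [J k]. *)
Lemma esum_bigcup_le (K T : choiceType) (S : set K) (J : K -> set T)
    (f : T -> \bar R) : (forall x, 0 <= f x) ->
  \esum_(x in \bigcup_(k in S) J k) f x <= \esum_(k in S) \esum_(x in J k) f x.
Proof.
move=> f0; rewrite esum_esum//.
have [[k0 _]|S0] := pselect (S !=set0); last first.
  rewrite (_ : \bigcup_(k in S) J k = set0) ?esum_set0 ?esum_ge0//.
  by rewrite -subset0 => x [k Sk _]; apply: S0; exists k.
have /choice[g gP] : forall x, exists k, (\bigcup_(k in S) J k) x -> S k /\ J k x.
  move=> x; have [[k Sk Jkx]|nx] := pselect ((\bigcup_(k in S) J k) x).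
    by exists k.
  by exists k0.
rewrite (_ : esum _ _ = \esum_(x in (fun x => (g x, x)) @` (\bigcup_(k in S) J k)) f x.2).
  by apply: le_esum_set => _ /= [x /gP[? ?] <-].
rewrite esum_image// => x y _ _; by case.
Qed.

Lemma esum_const_infinite (T : choiceType) (A : set T) (c : R) :
  (0 < c)%R -> infinite_set A -> \esum_(i in A) c%:E = +oo.
Proof.
move=> c0 infA; apply: eq_infty => M.
have [B BA Bn] := infinite_set_fset (Num.truncn (M / c)).+1 infA.
apply: esum_ge; exists [set` B] => //.
rewrite fsbig_finite// set_fsetK/= sumEFin lee_fin big_const_seq count_predT.
rewrite iter_addr_0 -mulr_natr mulrC -ler_pdivrMr//.
have [M0|M0] := leP 0%R (M / c)%R; last by rewrite (le_trans (ltW M0)).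
apply: le_trans (_ : ((Num.truncn (M / c)).+1%:R <= _)%R).
  by rewrite ltW// truncnS_gt.
by rewrite ler_nat.
Qed.

Lemma counting_le_esum (T : choiceType) (A : set T) :
  counting A <= \esum_(i in A) (1 : \bar R).
Proof.
rewrite /counting; case: asboolP => [finA|infA].
  rewrite esum_fset// fsbig_finite//= sumEFin big_const_seq count_predT.
  by rewrite iter_addr_0.
by rewrite esum_const_infinite.
Qed.

Lemma finite_set_lbound (T : choiceType) (A : set T) (f : T -> R) :
  finite_set A -> (forall i, A i -> 0 < f i)%R ->
  exists2 h : R, (0 < h)%R & forall i, A i -> (h < f i)%R.
Proof.
move=> finA f0; pose m := (\big[Num.min/1]_(x <- fset_set A) f x)%R.
have m0 : (0 < m)%R.
  rewrite /m big_seq; apply: lt_bigmin => // i.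
  by rewrite in_fset_set// inE => /f0.
exists (m / 2)%R; first by rewrite divr_gt0.
move=> i Ai; apply: (@lt_le_trans _ _ m).
  by rewrite ltr_pdivrMr// ltr_pMr// ltr1n.
by apply: bigmin_inf_seq (lexx _) => //; rewrite in_fset_set// inE.
Qed.

(** Some finite subset carries the sum up to [e]; a threshold [h] below every [r i] on that subset
    leaves only the remainder. *)
Lemma esum_tail (T : choiceType) (A : set T) (f : T -> \bar R) (r : T -> R)
    (e : R) :
  (forall i, A i -> 0 <= f i) -> (forall i, A i -> 0 < r i)%R ->
  \esum_(i in A) f i < +oo -> (0 < e)%R ->
  exists2 h : R, (0 < h)%R &
    \esum_(i in A `&` [set i | r i <= h]%R) f i <= e%:E.
Proof.
move=> f0 r0 fA e0.
have fAfin : \esum_(i in A) f i \is a fin_num.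
  by rewrite ge0_fin_numE// esum_ge0.
have [_ [X [finX XA] <-] ltX] : exists2 y, [set \sum_(x \in F) f x | F in fsets A] y & \esum_(i in A) f i - e%:E < y.
  by apply: ub_ereal_sup_adherent.
have [h h0 hP] := finite_set_lbound finX (fun i Xi => r0 i (XA i Xi)).
exists h => //.
rewrite leNgt; apply/negP => eB; move: ltX; apply/negP; rewrite -leNgt.
rewrite leeBrDr// [leRHS](esumID [set i | r i <= h]%R)// addeC.
apply: leeD; last exact: ltW.
apply: esum_ge; exists X => //; split=> // x Xx; split; first exact: XA.
by apply/negP; rewrite -ltNge hP.
Qed.

(** After exchanging the sums, each [j] is counted with at most [N j] elements of [F]. Both counts
    of spoiled centers are instances, with [N] supplied by packing. *)
Lemma le_esum_double_count (T1 T2 : choiceType) (F : set T1) (J : set T2)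
    (rel : T1 -> T2 -> Prop) (w N : T2 -> R) :
  (forall j, 0 <= w j)%R ->
  (forall j, J j -> \esum_(x in F `&` [set x | rel x j]) (1 : \bar R) <= (N j)%:E) ->
  \esum_(x in F) \esum_(j in J `&` [set j | rel x j]) (w j)%:E <=
  \esum_(j in J) (w j * N j)%:E.
Proof.
move=> w0 FN; under eq_esum do rewrite esum_mkcondr.
rewrite exchange_esum; last by move=> x j _ _; case: ifP; rewrite lee_fin.
apply: le_esum => j Jj; rewrite EFinM.
apply: le_trans (lee_wpmul2l (_ : 0 <= (w j)%:E) (FN _ Jj)); last by rewrite lee_fin.
apply: le_trans (esumZl_le _ _ _); rewrite ?w0//.
rewrite esum_mkcondr; apply: le_esum => x _.
by rewrite (_ : (j \in _) = (x \in [set x | rel x j])) ?mule1//; apply/idP/idP; rewrite !inE.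
Qed.

End esum_complements.

(** * Hausdorff measure and dimension *)

Section hausdorff_complements.
Context {R : realType} {X : metricType R}.
Implicit Types (A : set X) (s : R).
Local Open Scope ereal_scope.

Lemma diam_ge0 A : 0 <= diam A.
Proof. by apply: ereal_sup_ubound; left. Qed.

Lemma diam_set0 : diam (@set0 X) = 0.
Proof.
apply/eqP; rewrite eq_le diam_ge0 andbT; apply: ge_ereal_sup => z [->//|].
by case=> -[x y] [[]].
Qed.

Lemma le_diam A (r : R) : (0 <= r)%R ->
  (forall x y, A x -> A y -> (mdist x y <= r)%R) -> diam A <= r%:E.
Proof.
move=> r0 Ar; apply: ge_ereal_sup => z [->//|[[x y] [Ax Ay] <-]].
by rewrite lee_fin Ar.
Qed.

Lemma mdist_le_diam A x y : A x -> A y -> (mdist x y)%:E <= diam A.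
Proof. by move=> Ax Ay; apply: ereal_sup_ubound; right; exists (x, y). Qed.

Lemma diam_ball (x : X) (r : R) : diam (ball x r) <= (2 * `|r|)%:E.
Proof.
apply: le_diam => // y z; rewrite ballEmdist/= => xy xz.
apply: le_trans (metric_triangle y x z) _; rewrite mulrDl mul1r metric_sym.
by apply: lerD; apply: le_trans (ler_norm r); exact: ltW.
Qed.

Lemma hausdorff_premeasure_ge0 s delta A : 0 <= hausdorff_premeasure s delta A.
Proof.
apply: le_ereal_inf_tmp => _ [U _ <-].
by apply: nneseries_ge0 => n _ _; exact: poweR_ge0.
Qed.

Lemma hausdorff_measure_ge0 s A : 0 <= hausdorff_measure s A.
Proof.
apply: le_trans (hausdorff_premeasure_ge0 s 1 A) _.
by apply: ereal_sup_ubound; exists 1%R => /=.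
Qed.

Lemma le_hausdorff_measure s A B : A `<=` B ->
  hausdorff_measure s A <= hausdorff_measure s B.
Proof.
move=> AB; apply: ge_ereal_sup => _ [d d0 <-].
apply: le_trans (_ : hausdorff_premeasure s d B <= _).
  apply: le_ereal_inf => _ [U [BU Ud] <-]; exists U => //.
  by split => //; exact: subset_trans BU.
by apply: ereal_sup_ubound; exists d.
Qed.

Lemma le_hausdorff_dim A B : A `<=` B -> hausdorff_dim A <= hausdorff_dim B.
Proof.
move=> AB; apply: le_ereal_inf => _ [s [s0 sB] <-]; exists s => //; split=> //.
apply/eqP; rewrite eq_le hausdorff_measure_ge0 andbT -sB.
exact: le_hausdorff_measure.
Qed.

(** An injection of [S] into [nat] turns the family into a sequence; indices outside its image carry
    the empty set, which costs nothing because [s > 0]. *)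
Lemma hausdorff_premeasure_le_esum (I : choiceType) (S : set I)
    (V : I -> set X) s (delta : R) A :
  (0 < s)%R -> (0 <= delta)%R -> countable S -> A `<=` \bigcup_(i in S) V i ->
  (forall i, S i -> diam (V i) <= delta%:E) ->
  hausdorff_premeasure s delta A <= \esum_(i in S) diam (V i) `^ s.
Proof.
move=> s0 d0 /countable_injP[f finj] AV Vd.
pose U n := \bigcup_(i in S `&` [set i | f i = n]) V i.
have UE i : S i -> U (f i) = V i.
  move=> Si; apply/seteqP; split => [x [j [Sj ji] Vjx]|x Vix].
    by rewrite -(finj _ _ _ _ ji)//; exact/mem_set.
  by exists i.
have U0 n : ~ (f @` S) n -> U n = set0.
  by move=> nS; rewrite -subset0 => x [i [Si fi] _]; apply: nS; exists i.
have -> : \esum_(i in S) diam (V i) `^ s = \sum_(0 <= n <oo) diam (U n) `^ s.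
  rewrite nneseries_esumT; last by move=> n; exact: poweR_ge0.
  rewrite (esumID (f @` S)); last by move=> n _; exact: poweR_ge0.
  rewrite setTI setTI [X in _ + X]esum1 ?adde0; last first.
    by move=> n /U0 ->; rewrite diam_set0 poweR0r// gt_eqF.
  rewrite esum_image//.
  by apply: eq_esum => i Si; rewrite UE.
apply: ereal_inf_lbound; exists U => //; split => [x /AV[i Si Vix]|n].
  by exists (f i) => //; rewrite UE.
have [[i Si <-]|/U0 ->] := pselect ((f @` S) n); first by rewrite UE ?Vd.
by rewrite diam_set0 lee_fin.
Qed.

Lemma hausdorff_measure_eq0 s A : (0 < s)%R ->
  (forall delta e : R, (0 < delta)%R -> (0 < e)%R ->
    exists (I : choiceType) (S : set I) (V : I -> set X),
    [/\ countable S, A `<=` \bigcup_(i in S) V i,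
        forall i, S i -> diam (V i) <= delta%:E &
        \esum_(i in S) diam (V i) `^ s <= e%:E]) ->
  hausdorff_measure s A = 0.
Proof.
move=> s0 H; apply/eqP; rewrite eq_le hausdorff_measure_ge0 andbT.
apply: ge_ereal_sup => _ [d d0 <-]; apply/lee_addgt0Pr => e e0; rewrite add0e.
have [I [S [V [cS AV Vd Ve]]]] := H _ _ d0 e0.
by apply: le_trans Ve; apply: hausdorff_premeasure_le_esum => //; exact: ltW.
Qed.

(** One scale is enough: the premeasure at [delta = 1] bounds the measure from below, and covers at
    that scale have finite diameters. *)
Lemma hausdorff_measure_neq0 s A (eta : R) : (0 < eta)%R ->
  (forall U : (set X)^nat, (forall i, diam (U i) \is a fin_num) ->
     \sum_(0 <= i <oo) diam (U i) `^ s < eta%:E -> ~ A `<=` \bigcup_i U i) ->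
  hausdorff_measure s A <> 0.
Proof.
move=> eta0 H hA0; have : eta%:E <= hausdorff_measure s A.
  apply: le_trans (_ : hausdorff_premeasure s 1 A <= _); last first.
    by apply: ereal_sup_ubound; exists 1%R => /=.
  apply: le_ereal_inf_tmp => _ [U [AU Ud] <-]; rewrite leNgt; apply/negP => Us.
  apply: (H U) => // i; rewrite ge0_fin_numE ?diam_ge0//.
  by rewrite (le_lt_trans (Ud i))// ltry.
by rewrite hA0 lee_fin leNgt eta0.
Qed.

End hausdorff_complements.

(** * Packing in Ahlfors regular spaces *)

Section packing.
Context {R : realType} {X : completeMetricType R}.
Local Notation borelX := (g_sigma_algebraType (@open X)).

Lemma open_mdist_ball (x : X) (r : R) : open (ball x r).
Proof.
rewrite openE => y; rewrite ballEmdist /= => xy; apply/nbhs_ballP.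
exists (r - mdist x y); first by rewrite /= subr_gt0.
move=> z; rewrite !ballEmdist/= => yz.
by rewrite (le_lt_trans (metric_triangle x y z))// -ltrBrDl.
Qed.

Lemma measurable_mdist_ball (x : X) (r : R) : measurable (ball x r : set borelX).
Proof. by apply: sub_sigma_algebra; exact: open_mdist_ball. Qed.

(** The balls of radius [t / 2] about points of [P] are disjoint and lie in the ball of radius
    [r + t / 2] about [y]; comparing measures bounds the size of every finite subset of [P]. *)
Lemma packing (mu : {measure set borelX -> \bar R}) (alpha Cm D : R)
    (P : set X) (y : X) (r t : R) :
  0 < Cm ->
  (forall x s, 0 < s -> s <= D ->
     ((s `^ alpha / Cm)%:E <= mu (ball x s : set X) <= (Cm * s `^ alpha)%:E)%E) ->
  0 <= r -> 0 < t -> r + t / 2 <= D ->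
  (forall x, P x -> mdist y x <= r) ->
  (forall x z, P x -> P z -> x <> z -> t <= mdist x z) ->
  (\esum_(x in P) (1 : \bar R) <= (Cm ^+ 2 * ((2 * r + t) / t) `^ alpha)%:E)%E.
Proof.
move=> Cm0 ahl r0 t0 rtD Py Psep; apply: ge_ereal_sup => _ [Y [finY YP] <-].
have t20 : 0 < t / 2 by rewrite divr_gt0.
have t2D : t / 2 <= D by rewrite (le_trans _ rtD)// lerDr.
have rt0 : 0 < r + t / 2 by rewrite (lt_le_trans t20)// lerDr.
pose c := (t / 2) `^ alpha / Cm.
have c0 : 0 < c by rewrite divr_gt0// powR_gt0.
have sumc (a : R) : (\sum_(x \in Y) a%:E = (#|` fset_set Y|%:R * a)%:E)%E.
  rewrite fsbig_finite//= sumEFin big_const_seq count_predT iter_addr_0.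
  by rewrite mulr_natl.
rewrite sumc mulr1 lee_fin.
have le1 : ((#|` fset_set Y|%:R * c)%:E <= mu (\bigcup_(x in Y) ball x (t / 2) : set X))%E.
  rewrite -sumc measure_fin_bigcup//; last 2 first.
  - move=> x z Yx Yz [w []]; rewrite !ballEmdist/= => xw zw.
    apply: contrapT => xz; have := Psep _ _ (YP _ Yx) (YP _ Yz) xz.
    apply/negP; rewrite -ltNge [ltRHS]splitr.
    by rewrite (le_lt_trans (metric_triangle x w z))// ltrD// metric_sym.
  - by move=> x _; exact: measurable_mdist_ball.
  apply: lee_fsum => [//|x Yx]; rewrite /c; by have /andP[] := ahl x _ t20 t2D.
have le2 : (mu (\bigcup_(x in Y) ball x (t / 2) : set X) <= (Cm * (r + t / 2) `^ alpha)%:E)%E.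
  apply: le_trans (_ : (mu (ball y (r + t / 2) : set X) <= _)%E); last first.
    by have /andP[] := ahl y _ rt0 rtD.
  apply: le_measure; rewrite ?inE.
  - apply: fin_bigcup_measurable => // x _; exact: measurable_mdist_ball.
  - exact: measurable_mdist_ball.
  move=> z [x Yx]; rewrite !ballEmdist/= => xz.
  rewrite (le_lt_trans (metric_triangle y x z))// ler_ltD//.
  exact/Py/YP.
have := le_trans le1 le2; rewrite lee_fin -ler_pdivlMr// => /le_trans; apply.
have -> : (2 * r + t) / t = (r + t / 2) / (t / 2) by field; rewrite gt_eqF.
rewrite powRM ?invr_ge0// ?(ltW rt0) ?(ltW t20)//.
rewrite -[(t / 2)^-1]powR_inv1 ?(ltW t20)// -powRrM mulN1r powRN /c.
rewrite le_eqVlt; apply/orP; left; apply/eqP.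
have := powR_gt0 alpha t20; set p := (t / 2) `^ alpha => p0.
by field; rewrite !gt_eqF.
Qed.

End packing.

(** * Real numbers and nested balls *)

Section real_complements.
Context {R : realType}.

Lemma esum_geometric_lty (a z : R) : 0 <= a -> 0 < z < 1 ->
  (\esum_(n in [set: nat]) (a * z ^+ n)%:E < +oo)%E.
Proof.
move=> a0 /andP[z0 z1]; rewrite -nneseries_esumT; last first.
  by move=> n; rewrite lee_fin mulr_ge0// exprn_ge0// ltW.
apply: le_lt_trans (ltry (a * (1 - z)^-1)).
apply: lime_le.
  by apply: is_cvg_nneseries => n _ _; rewrite lee_fin mulr_ge0// exprn_ge0// ltW.
apply: nearW => n; rewrite sumEFin lee_fin.
by apply: (geometric_le_lim n) => //; rewrite gtr0_norm.
Qed.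

Lemma powR_div (x y a : R) : 0 <= x -> 0 <= y ->
  (x / y) `^ a = x `^ a / y `^ a.
Proof.
by move=> x0 y0; rewrite powRM ?invr_ge0// -powR_inv1// -powRrM mulN1r powRN.
Qed.

(** Passes from a real scale [t] to an index of well-distribution: for [k] the integer part of
    [(C * t)^-1], the least radius [(C * k%:R)^-1] is at least [t] and comparable to it. *)
Lemma exists_scale (C : R) (k0 : nat) : 1 <= C ->
  exists2 h : R, 0 < h & forall t, 0 < t -> t <= h -> exists k : nat,
    [/\ (k0 <= k)%N, (0 < k)%N, t <= (C * k%:R)^-1 & k%:R^-1 <= 2 * C * t].
Proof.
move=> C1; have C0 : 0 < C by rewrite (lt_le_trans ltr01).
exists (C * k0.+1%:R)^-1; first by rewrite invr_gt0 mulr_gt0// ltr0n.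
move=> t t0 th; have Ct0 : 0 < C * t by rewrite mulr_gt0.
have k0Ct : k0.+1%:R <= (C * t)^-1.
  rewrite -[leLHS]invrK lef_pV2 ?posrE ?invr_gt0// ?ltr0n//.
  by rewrite -ler_pdivlMl// -invfM.
have Ct' : 0 <= (C * t)^-1 by rewrite invr_ge0 ltW.
pose k := Num.truncn (C * t)^-1.
have k0k : (k0 < k)%N by rewrite truncn_ge_nat.
have kpos : (0 < k)%N by rewrite (leq_ltn_trans _ k0k).
have k_le : k%:R <= (C * t)^-1 by rewrite truncn_le.
have k_gt : (C * t)^-1 < k.+1%:R by rewrite truncnS_gt.
have k0' : 0 < k%:R :> R by rewrite ltr0n.
exists k; split => //; first exact: ltnW.
- rewrite -[leLHS]invrK lef_pV2 ?posrE ?invr_gt0// ?mulr_gt0//.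
  by rewrite -ler_pdivlMl// -invfM.
- rewrite -[leRHS]invrK lef_pV2 ?posrE ?invr_gt0 ?mulr_gt0// -mulrA invfM.
  rewrite ler_pdivrMl// (le_trans (ltW k_gt))// -natr1 mulrDl mul1r lerD2l.
  by rewrite ler1n.
Qed.

Lemma dyadic_shell (D t : R) : 0 < t -> t <= D ->
  exists n : nat, D * 2^-1 ^+ n.+1 < t <= D * 2^-1 ^+ n.
Proof.
move=> t0 tD; have D0 : 0 < D by exact: lt_le_trans tD.
have ex : exists n : nat, D * 2^-1 ^+ n.+1 < t.
  exists (Num.truncn (D / t)); rewrite exprVn ltr_pdivrMr ?exprn_gt0//.
  rewrite -ltr_pdivrMl// mulrC (lt_le_trans (truncnS_gt _))//.
  by rewrite -natrX ler_nat ltnW// ltn_expl.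
have [n nP nmin] := ex_minnP ex; exists n; rewrite nP/=.
case: n nP nmin => [|n] nP nmin; first by rewrite expr0 mulr1.
by rewrite leNgt; apply/negP => /nmin; rewrite ltnn.
Qed.

End real_complements.

Section nested_balls.
Context {R : realType}.

(** All centers from the [n]-th on stay in [ball (y n) (rho n)], so having some [rho n] below each
    [e] makes the centers Cauchy; completeness gives the limit. *)
Lemma nested_balls_limit (X : completeMetricType R) (y : nat -> X) (rho : nat -> R) :
  (forall e : R, 0 < e -> exists n, rho n < e) ->
  (forall n, 0 < rho n) ->
  (forall n, cball (y n.+1) (rho n.+1) `<=` ball (y n) (rho n)) ->
  exists x, forall n, cball (y n) (rho n) x.
Proof.
move=> rho_cvg rho0 nested.
have near n m : (n <= m)%N -> ball (y n) (rho n) (y m).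
  move=> /subnK <-; elim: (m - n)%N => [|k IH]; first by rewrite add0n; exact: ballxx.
  have sub j : ball (y (j + n)%N) (rho (j + n)%N) `<=` ball (y n) (rho n).
    elim: j => [|j IHj] //; apply: subset_trans IHj; rewrite addSn.
    apply: subset_trans (@nested _) => z; rewrite ballEmdist /cball/=.
    exact: ltW.
  by apply: (sub k.+1); exact: ballxx.
have yc : cvg (y n @[n --> \oo]).
  apply/cauchy_cvgP/cauchy_ballP => e e0; near_simpl.
  have [n rn] := rho_cvg (e / 2) (divr_gt0 e0 (ltr0n _ 2)).
  have H m : (n <= m)%N -> mdist (y n) (y m) < e / 2.
    by move=> /near; rewrite ballEmdist/= => /lt_trans; apply.
  exists ([set m | (n <= m)%N], [set m | (n <= m)%N]) => /=.
    by split; exists n.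
  move=> [i j] /= [/H ni /H nj]; rewrite ballEmdist/= [ltRHS]splitr.
  apply: le_lt_trans (metric_triangle _ (y n) _) _.
  by rewrite ltrD// metric_sym.
exists (lim (y n @[n --> \oo])) => n; rewrite /cball/=.
apply/ler_addgt0Pr => e e0.
move/cvg_ballP : yc => /(_ _ e0)[N _ NP].
have := NP (maxn n N); rewrite /= leq_maxr => /(_ isT).
rewrite ballEmdist/= metric_sym => H.
have := near n _ (leq_maxl n N); rewrite ballEmdist/= => H2.
by apply: le_trans (metric_triangle _ (y (maxn n N)) _) _; rewrite lerD// ltW.
Qed.

End nested_balls.

(** * Covering the limsup set *)

Section approximation_setting.
Context {R : realType} {X : completeMetricType R}.
Local Notation borelX := (g_sigma_algebraType (@open X)).
Context (mu : {measure set borelX -> \bar R}).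
Context (alpha Cm D C M : R) (Q : set X) (rad : X -> R) (psi : R -> R).
Context (alpha_gt0 : 0 < alpha) (Cm_gt0 : 0 < Cm) (D_gt0 : 0 < D) (C_ge1 : 1 <= C).
(* [D] is a positive lower bound of the diameter of the space. *)
Context (mu_ball : forall x s, 0 < s -> s <= D ->
  ((s `^ alpha / Cm)%:E <= mu (ball x s : set X) <= (Cm * s `^ alpha)%:E)%E).
Context (annulus_neq0 : forall (x : X) r1 r2, 0 < r1 -> r1 < r2 -> r2 <= D ->
  exists y, r1 <= mdist x y <= r2).
Context (Q_countable : countable Q).
Context (rad_gt0 : forall xi, Q xi -> 0 < rad xi).
Context (rad_leM : forall xi, Q xi -> rad xi <= M).
Context (Q_sep : well_separated Q rad C) (Q_dist : well_distributed mu alpha Q rad C).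
Context (psi_gt0 : forall x : R, 0 < x -> 0 < psi x).
Context (psi_ndecr : forall x y : R, 0 < x -> x <= y -> psi x <= psi y).
Context (psi_series :
  (\esum_(xi in Q) ((psi (rad xi) / rad xi) `^ alpha)%:E < +oo)%E).
Context (x0 : X).

Let C_gt0 : 0 < C. Proof. by rewrite (lt_le_trans ltr01). Qed.

(** By monotonicity of [psi] and [rad xi <= M], each such point contributes at least the [alpha]-th
    power of [psi r / M] to the convergent series. *)
Lemma finite_rad_ge (r : R) : 0 < r -> finite_set (Q `&` [set xi | r <= rad xi]).
Proof.
move=> r0; apply: contrapT => inf.
have [xi [Qxi /= rxi]] := infinite_setN0 inf.
have M0 : 0 < M by rewrite (lt_le_trans r0)// (le_trans rxi)// rad_leM.
have c0 : 0 < (psi r / M) `^ alpha by rewrite powR_gt0// divr_gt0// psi_gt0.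
move: psi_series; apply/negP; rewrite -leNgt.
rewrite -(@esum_const_infinite _ _ _ _ c0 inf).
apply: le_trans; last first.
  by apply: (@le_esum_set _ _ (Q `&` [set xi | r <= rad xi]) Q); exact: subIsetl.
apply: le_esum => z [Qz /= rz]; rewrite lee_fin; apply: ge0_ler_powR.
- exact: ltW.
- by rewrite nnegrE divr_ge0 ?ltW// psi_gt0.
- by rewrite nnegrE divr_ge0 ?ltW// ?psi_gt0// rad_gt0.
- apply: ler_pM => //; first by rewrite ltW// psi_gt0.
  + by rewrite invr_ge0 ltW.
  + exact: psi_ndecr.
  + by rewrite lef_pV2 ?posrE ?rad_leM// rad_gt0.
Qed.

Lemma well_distributed_points (y : X) (r : R) : 0 < r -> r <= D ->
  exists k0 : nat, forall k : nat, (k0 <= k)%N -> exists F : set X,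
    [/\ F `<=` Q, forall xi, F xi -> (C * k%:R)^-1 <= rad xi <= C / k%:R,
        forall xi, F xi -> ball xi (rad xi) `<=` ball y r &
        ((C^-1 * k%:R `^ alpha * (r `^ alpha / Cm))%:E
          <= \esum_(xi in F) (1 : \bar R))%E].
Proof.
move=> r0 rD; have [k0 k0P] := Q_dist y r0; exists k0 => k /k0P[F [FQ Frad Fball Fcard]].
exists F; split => //.
  by move=> xi Fxi z xiz; apply: Fball; exists xi.
apply: le_trans (counting_le_esum F); apply: le_trans Fcard.
rewrite EFinM; apply: lee_wpmul2l; last by have /andP[] := mu_ball y r0 rD.
by rewrite lee_fin mulr_ge0 ?powR_ge0// invr_ge0 ltW.
Qed.

Lemma well_distributed_neq0 (y : X) (r : R) : 0 < r -> r <= D ->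
  exists k0 : nat, forall k : nat, (k0 <= k)%N -> (0 < k)%N ->
    exists2 xi, Q xi & (C * k%:R)^-1 <= rad xi <= C / k%:R.
Proof.
move=> r0 rD; have [k0 k0P] := well_distributed_points y r0 rD.
exists k0 => k /k0P[F [FQ Frad _ Fcard]] kpos.
have [[xi Fxi]|F0] := pselect (F !=set0); first by exists xi; [exact: FQ|exact: Frad].
move: Fcard; rewrite esum1 => [|i Fi]; last by exfalso; apply: F0; exists i.
by rewrite lee_fin leNgt !mulr_gt0 ?invr_gt0 ?divr_gt0 ?powR_gt0 ?ltr0n.
Qed.

(* The terms of the series over [rad xi <= h] tend to 0, and well-distribution
   puts some [rad xi] within a constant factor of any small [t]. *)
Lemma psi_littleo (e : R) : 0 < e ->
  exists2 h, 0 < h & forall t, 0 < t -> t <= h -> psi t <= e * t.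
Proof.
(* The factor [2 * C ^+ 2] pays for replacing [t] by the radius of a point of [Q] with
   [t <= rad xi <= 2 * C ^+ 2 * t]. *)
move=> e0; pose e' := e / (2 * C ^+ 2).
have C20 : 0 < 2 * C ^+ 2 by rewrite mulr_gt0// exprn_gt0.
have e'0 : 0 < e' by rewrite divr_gt0.
have e'a : 0 < e' `^ alpha by rewrite powR_gt0.
have f0 xi : (0 <= ((psi (rad xi) / rad xi) `^ alpha)%:E)%E.
  by rewrite lee_fin powR_ge0.
have [h h0 hP] := esum_tail (fun xi _ => f0 xi) rad_gt0 psi_series e'a.
have psi_rad xi : Q xi -> rad xi <= h -> psi (rad xi) <= e' * rad xi.
  move=> Qxi xih; have r0 := rad_gt0 Qxi.
  rewrite -ler_pdivrMr// leNgt; apply/negP => lt_e'.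
  have : (((psi (rad xi) / rad xi) `^ alpha)%:E <= (e' `^ alpha)%:E)%E.
    apply: le_trans hP.
    rewrite -[leLHS](@esum_set1 _ _ xi (fun i => ((psi (rad i) / rad i) `^ alpha)%:E))//.
    by apply: le_esum_set => _ ->.
  rewrite lee_fin leNgt => /negP; apply; apply: gt0_ltr_powR => //.
    by rewrite nnegrE ltW.
  by rewrite nnegrE divr_ge0 ?ltW// psi_gt0.
have [k0 k0P] := well_distributed_neq0 x0 D_gt0 (lexx D).
have [h1 h10 h1P] := exists_scale k0 C_ge1.
exists (Num.min h1 (h / (2 * C ^+ 2))); first by rewrite lt_min h10 divr_gt0.
move=> t t0; rewrite le_min => /andP[th1 th].
have [k [k0k kpos tk kt]] := h1P _ t0 th1.
have [xi Qxi /andP[xi1 xi2]] := k0P _ k0k kpos.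
have xi3 : rad xi <= 2 * C ^+ 2 * t.
  rewrite (le_trans xi2)// (_ : 2 * C ^+ 2 * t = C * (2 * C * t)); last by ring.
  by rewrite ler_pM2l.
apply: le_trans (psi_ndecr t0 (le_trans tk xi1)) _.
apply: le_trans (psi_rad _ Qxi _) _.
  by rewrite (le_trans xi3)// -ler_pdivlMl// mulrC.
rewrite (_ : e * t = e' * (2 * C ^+ 2 * t)); first by rewrite ler_pM2l.
by rewrite /e'; field; rewrite gt_eqF.
Qed.

Lemma Wset_small_rad (e : R) (x : X) : 0 < e -> Wset psi Q rad x ->
  exists xi, [/\ Q xi, mdist x xi < psi (rad xi) & rad xi <= e].
Proof.
move=> e0 Wx; apply: contrapT => H; apply: Wx.
apply: sub_finite_set (finite_rad_ge e0) => xi [Qxi xxi]; split => //=.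
by rewrite leNgt; apply/negP => xie; apply: H; exists xi; split => //; exact: ltW.
Qed.

(** In the dyadic shell with [p = 2^-1 ^+ n], separation and packing leave of the order of [p] to
    the power [- alpha] points, each contributing at most of the order of [p] to the power [g]. The
    shells thus sum like a geometric series of ratio [z]. *)
Lemma local_sum_lty (q : X) (g : R) : alpha < g ->
  (\esum_(xi in Q `&` [set xi | mdist q xi <= D / 2 /\ rad xi <= D]%R)
      (rad xi `^ g)%:E < +oo)%E.
Proof.
move=> ag; pose z : R := 2^-1 `^ (g - alpha).
have z01 : 0 < z < 1.
  rewrite powR_gt0//= (_ : 1 = 1 `^ (g - alpha)); last by rewrite powR1.
  apply: gt0_ltr_powR; rewrite ?subr_gt0// ?nnegrE//.
  by rewrite invf_lt1// ltr1n.
pose K := Cm ^+ 2 * (4 * C) `^ alpha * D `^ g.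
have K0 : 0 <= K by rewrite !mulr_ge0 ?powR_ge0 ?exprn_ge0 ?ltW.
apply: le_lt_trans (esum_geometric_lty K0 z01).
pose A (n : nat) := Q `&` [set xi | mdist q xi <= D / 2 /\
   D * 2^-1 ^+ n.+1 < rad xi <= D * 2^-1 ^+ n].
apply: le_trans (_ : (\esum_(n in [set: nat]) \esum_(xi in A n) (rad xi `^ g)%:E <= _)%E).
  apply: le_trans _ (esum_bigcup_le _ _ _); last by move=> x; rewrite lee_fin powR_ge0.
  apply: le_esum_set => xi [Qxi [qxi xiD]].
  have [n nP] := dyadic_shell (rad_gt0 Qxi) xiD.
  by exists n.
apply: le_esum => n _.
(* Radii in the shell exceed [D * 2^-1 ^+ n.+1], so well-separation keeps its points [t] apart. *)
pose t := D * 2^-1 ^+ n.+1 / C.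
have p0 : 0 < D * 2^-1 ^+ n by rewrite mulr_gt0// exprn_gt0// invr_gt0.
have p1 : 0 < D * 2^-1 ^+ n.+1 by rewrite mulr_gt0// exprn_gt0// invr_gt0.
have t0 : 0 < t by rewrite divr_gt0.
have tD2 : t <= D / 2.
  rewrite /t ler_pdivrMr// exprS mulrA ler_pM2l ?divr_gt0//.
  by apply: le_trans C_ge1; rewrite exprn_ile1// invf_le1// ler1n.
apply: le_trans (_ : (\esum_(xi in A n) ((D * 2^-1 ^+ n) `^ g)%:E * 1 <= _)%E).
  apply: le_esum => xi [Qxi [_ /andP[_ xin]]]; rewrite mule1 lee_fin.
  apply: ge0_ler_powR => //; rewrite ?nnegrE ?ltW ?rad_gt0//.
  exact: lt_trans ag.
apply: le_trans (esumZl_le _ _ _) _; rewrite ?powR_ge0//.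
have Asep xi zeta : A n xi -> A n zeta -> xi <> zeta -> t <= mdist xi zeta.
  move=> [Qxi [_ /andP[xi1 _]]] [Qzeta [_ /andP[zeta1 _]]] xizeta.
  apply: le_trans (Q_sep Qxi Qzeta xizeta); rewrite /t mulrC ler_pM2l ?invr_gt0//.
  by rewrite le_min !ltW.
have D2 : 0 <= D / 2 by rewrite divr_ge0 ?ltW.
have D2t : D / 2 + t / 2 <= D by lra.
have := packing (P := A n) Cm_gt0 mu_ball D2 t0 D2t (fun xi xiA => xiA.2.1) Asep.
move=> /(lee_wpmul2l _)/le_trans; apply; first by rewrite lee_fin powR_ge0.
rewrite -EFinM lee_fin; set p : R := 2^-1 ^+ n in p0 *.
have pp : 0 < p by rewrite exprn_gt0// invr_gt0.
have tE : t = D * p / (2 * C) by rewrite /t exprS -/p; field; rewrite gt_eqF.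
have le4 : (2 * (D / 2) + t) / t <= 4 * C / p.
  rewrite ler_pdivrMr// (_ : 4 * C / p * t = 2 * D); first by lra.
  by rewrite tE; field; rewrite !gt_eqF.
have zE : z ^+ n = p `^ g / p `^ alpha.
  rewrite -powRB ?gt_eqF ?implybT// /z /p -!powR_mulrn ?powR_ge0 ?invr_ge0//.
  by rewrite powRAC.
rewrite zE powRM ?(ltW D_gt0) ?(ltW pp)// /K.
set w := ((2 * (D / 2) + t) / t) `^ alpha.
have : w <= (4 * C) `^ alpha / p `^ alpha.
  have ? : 0 <= 4 * C by rewrite mulr_ge0// ltW.
  rewrite -powR_div ?(ltW pp)//; apply: ge0_ler_powR => //.
  - exact: ltW.
  - rewrite nnegrE; apply: divr_ge0 (ltW t0); apply: addr_ge0 (ltW t0).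
    exact: mulr_ge0.
  - by rewrite nnegrE; apply: divr_ge0 (ltW pp).
move=> /(ler_wpM2l (_ : 0 <= D `^ g * p `^ g * Cm ^+ 2)) H.
rewrite (mulrA _ _ w); apply: le_trans (H _) _; first by rewrite !mulr_ge0 ?powR_ge0 ?exprn_ge0 ?ltW.
by rewrite le_eqVlt; apply/orP; left; apply/eqP; ring.
Qed.

(** The sum of the [g]-th powers of the radii is controlled only near a given point. The cover is
    therefore assembled over all [q] in [Q], each [q] having its own threshold [eta q] and its own
    share [w q] of the error. *)
Lemma Wset_hausdorff_measure0 (s : R) : 0 < s ->
  (exists g e : R, [/\ alpha < g, 0 < e &
     forall t, 0 < t -> t < e -> psi t `^ s <= t `^ g]) ->
  hausdorff_measure s (Wset psi Q rad) = 0%E.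
Proof.
move=> s0 [g [e [ag e0 psi_g]]]; have [h h0 psi_le] := psi_littleo ltr01.
apply: hausdorff_measure_eq0 => // delta e1 delta0 e10.
have [f finj] := countable_injP _ Q_countable.
pose A q := Q `&` [set xi | mdist q xi <= D / 2 /\ rad xi <= D].
pose d := 2^-1 `^ s * e1.
(* The power of 2 cancels the one coming from the diameters of the balls; the dyadic weights sum to
   at most [e1] because [f] is injective on [Q]. *)
pose w q := 2 `^ (- s) * (e1 / (2 ^ (f q).+1)%:R).
have w0 q : 0 < w q.
  by rewrite mulr_gt0 ?powR_gt0// divr_gt0// ltr0n expn_gt0.
have /choice[eta etaP] : forall q, exists h, 0 < h /\
    (\esum_(xi in A q `&` [set xi | (rad xi <= h)%R]) (rad xi `^ g)%:E <= (w q)%:E)%E.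
  move=> q; have [||||h1 h10 h1P] := @esum_tail R X (A q) (fun xi => (rad xi `^ g)%:E) rad (w q).
  - by move=> xi _; rewrite lee_fin powR_ge0.
  - by move=> xi [/rad_gt0].
  - exact: local_sum_lty.
  - exact: w0.
  by exists h1.
pose m := Num.min h (Num.min (e / 2) (Num.min (D / 4) (delta / 2))).
have m0 : 0 < m by rewrite !lt_min h0 !divr_gt0.
have mP t : t <= m -> [/\ t <= h, t < e, t <= D / 4 & t <= delta / 2].
  rewrite !le_min => /and4P[th te tD td]; split => //.
  by rewrite (le_lt_trans te)// ltr_pdivrMr// ltr_pMr// ltr1n.
pose S := \bigcup_(q in Q) (A q `&` [set xi | rad xi <= Num.min m (eta q)]).
have SQ : S `<=` Q by move=> xi [q _ [[]]].
have Sm xi : S xi -> rad xi <= m by move=> [q _ [_ /=]]; rewrite le_min => /andP[].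
exists X, S, (fun xi => ball xi (psi (rad xi))); split.
- exact: sub_countable (subset_card_le SQ) Q_countable.
(* A first point [q] locates [x]. Only then is the threshold [eta q] known, and a second point [xi]
   is taken below it. *)
- move=> x Wx; have [q [Qq xq qm]] := Wset_small_rad m0 Wx.
  have m1 : 0 < Num.min m (eta q) by rewrite lt_min m0 (etaP q).1.
  have [xi [Qxi xxi xim]] := Wset_small_rad m1 Wx.
  exists xi; last by rewrite ballEmdist/= metric_sym.
  have xim1 : rad xi <= m by move: xim; rewrite le_min => /andP[].
  have [qh _ qD _] := mP _ qm; have [xih _ xiD _] := mP _ xim1.
  have := psi_le _ (rad_gt0 Qq) qh; have := psi_le _ (rad_gt0 Qxi) xih.
  rewrite !mul1r => ? ?; have tri := metric_triangle q x xi.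
  exists q => //; split => //; split => //; split; last by move: D_gt0; lra.
  by rewrite (metric_sym q x) in tri; lra.
- move=> xi Sxi; have r0 := rad_gt0 (SQ _ Sxi).
  have [xih _ _ xid] := mP _ (Sm _ Sxi).
  apply: le_trans (diam_ball _ _) _; rewrite lee_fin gtr0_norm ?psi_gt0//.
  by have := psi_le _ r0 xih; lra.
apply: le_trans (_ : (\esum_(xi in S) (2 `^ s)%:E * (rad xi `^ g)%:E <= _)%E).
  apply: le_esum => xi Sxi; have r0 := rad_gt0 (SQ _ Sxi).
  have [xih xie _ xid] := mP _ (Sm _ Sxi).
  apply: le_trans (_ : ((2 * psi (rad xi))%:E `^ s <= _)%E).
    apply: gt0_ler_poweR; first exact: ltW.
    - by rewrite in_itv/= diam_ge0 leey.
    - by rewrite in_itv/= leey andbT lee_fin mulr_ge0// ltW// psi_gt0.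
    - by apply: le_trans (diam_ball _ _) _; rewrite gtr0_norm ?psi_gt0.
  rewrite poweR_EFin -EFinM lee_fin powRM// ?(ltW (psi_gt0 _))//.
  by rewrite ler_pM2l ?powR_gt0// psi_g.
apply: le_trans (esumZl_le _ _ _) _; rewrite ?powR_ge0//.
  by move=> xi; rewrite lee_fin powR_ge0.
apply: (@le_trans _ _ ((2 `^ s)%:E * \esum_(q in Q) (w q)%:E)%E).
  apply: lee_wpmul2l; first by rewrite lee_fin powR_ge0.
  apply: le_trans (esum_bigcup_le _ _ _) _.
    by move=> xi; rewrite lee_fin powR_ge0.
  apply: le_esum => q Qq; apply: le_trans (etaP q).2; apply: le_esum_set.
  by move=> xi [Axi /=]; rewrite le_min => /andP[].
apply: (@le_trans _ _ ((2 `^ s)%:E * ((2 `^ (- s))%:E *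
    \esum_(q in Q) (e1 / (2 ^ (f q).+1)%:R)%:E))%E).
  apply: lee_wpmul2l; first by rewrite lee_fin powR_ge0.
  apply: le_trans (esumZl_le _ _ _) => [||q]; rewrite ?powR_ge0//.
  by rewrite lee_fin divr_ge0// ltW.
rewrite muleA -EFinM powRN divff ?gt_eqF ?powR_gt0// mul1e.
rewrite -(@esum_image _ _ _ Q f (fun n => (e1 / (2 ^ n.+1)%:R)%:E))//.
apply: le_trans (epsilon_trick0 xpredT (ltW e10)).
rewrite nneseries_esumT; last by move=> n; rewrite lee_fin divr_ge0// ltW.
exact: le_esum_set.
Qed.

(** [K1] and [K2] are the packing constants of the two counts of spoiled centers. [c] is the density
    constant of well-distributed points when counted at separation [t = (C ^+ 2 * k%:R)^-1]. In
    [kappa], the bound 1 excludes cover sets larger than the current ball, and [c / (4 * K2)] fits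
    the second count into its budget. *)
Let K1 : R := Cm ^+ 2 * 6 `^ alpha.
Let K2 : R := Cm ^+ 2 * 4 `^ alpha.
Let c : R := C^-1 * (C ^+ 2) `^ (- alpha) / Cm.
Let kappa : R := Num.min 1 (c / (4 * K2)).

Let K1_gt0 : 0 < K1. Proof. by rewrite mulr_gt0 ?exprn_gt0 ?powR_gt0. Qed.
Let K2_gt0 : 0 < K2. Proof. by rewrite mulr_gt0 ?exprn_gt0 ?powR_gt0. Qed.
Let c_gt0 : 0 < c.
Proof. by rewrite divr_gt0// mulr_gt0 ?invr_gt0// powR_gt0// exprn_gt0. Qed.
Let kappa_gt0 : 0 < kappa.
Proof. by rewrite lt_min ltr01 divr_gt0// mulr_gt0. Qed.

(** * A point of exact approximation avoiding a cover *)

Section cover.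
Context (s : R) (s_gt0 : 0 < s) (s_lt : s < alpha).
Context (U : nat -> set X) (v : nat -> R) (v_gt0 : forall i, 0 < v i).
(* [v i] is a positive upper bound of [diam (U i) `^ s]. *)
Context (U_diam : forall i x z, U i x -> U i z -> mdist x z <= v i `^ s^-1).

Let meets (B : set X) := [set i | U i `&` B !=set0].
Let load (B : set X) := (\esum_(i in meets B) (v i)%:E)%E.
(** Up to a constant, an upper bound for the total measure of the small balls
    [ball xi (psi (rad xi))] with [rad xi <= sigma]. *)
Let small_sum (sigma : R) :=
  (\esum_(xi in Q `&` [set xi | (rad xi <= sigma)%R]) (psi (rad xi) `^ alpha)%:E)%E.
Let separated (F : set X) (t : R) :=
  forall xi zeta, F xi -> F zeta -> xi <> zeta -> t <= mdist xi zeta.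

(** * Counting spoiled centers *)

(** For fixed [zeta], packing bounds the number of [xi] within [2 * psi (rad zeta)]; the condition
    [t <= 2 * psi (rad zeta)] absorbs the additive [t], whence
    [(4 * psi + t) / t <= 6 * psi / t]. *)
Lemma count_near_centers (F : set X) (t sigma : R) :
  0 < t -> separated F t -> 3 * sigma <= D ->
  (forall r, 0 < r -> r <= sigma -> psi r <= r) ->
  (\esum_(xi in F) \esum_(zeta in (Q `&` [set zeta | (rad zeta <= sigma)%R]) `&`
      [set zeta | (t <= 2 * psi (rad zeta) /\ mdist zeta xi < 2 * psi (rad zeta))%R])
    (1%R)%:E <= (K1 / t `^ alpha)%:E * small_sum sigma)%E.
Proof.
move=> t0 Fsep sD psi_le.
pose N zeta := K1 / t `^ alpha * psi (rad zeta) `^ alpha.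
apply: le_trans (le_esum_double_count (N := N) _ _) _ => //.
  move=> zeta [Qzeta /= zs]; have r0 := rad_gt0 Qzeta.
  have p0 := psi_gt0 r0; have pr := psi_le _ r0 zs.
  have [tp|tp] := leP t (2 * psi (rad zeta)); last first.
    rewrite esum1; last by move=> i [_ []].
    by rewrite lee_fin /N !mulr_ge0 ?invr_ge0 ?powR_ge0// ltW.
  have Hr : 0 <= 2 * psi (rad zeta) by lra.
  have Hrt : 2 * psi (rad zeta) + t / 2 <= D by lra.
  apply: le_trans (packing (y := zeta) Cm_gt0 mu_ball Hr t0 Hrt _ _) _.
  - by move=> x [_ [_ /ltW]].
  - by move=> x z [Fx _] [Fz _]; exact: Fsep.
  rewrite lee_fin /N /K1 (_ : _ / _ * _ = Cm ^+ 2 * (6 `^ alpha * psi (rad zeta) `^ alpha / t `^ alpha)); last by ring.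
  rewrite ler_pM2l ?exprn_gt0// -powRM ?(ltW p0)// -powR_div ?(ltW t0)//; last by lra.
  apply: ge0_ler_powR; first exact: ltW.
  - by rewrite nnegrE divr_ge0 ?(ltW t0)//; lra.
  - by rewrite nnegrE divr_ge0 ?(ltW t0)//; lra.
  - by rewrite ler_pM2r ?invr_gt0//; lra.
apply: le_trans (esumZl_le _ _ _).
- by apply: le_esum => zeta _; rewrite mul1r.
- by rewrite divr_ge0 ?powR_ge0// ltW.
- by move=> zeta; rewrite lee_fin powR_ge0.
Qed.

(** A cover set of size [e i] meets of the order of 1 plus the [alpha]-th power of [e i / t] of the
    separated balls. Truncating weights at [a] still detects a total weight of at least [a], and it
    puts the factor [a] into the second term, where it cancels on division by [a]. *)
Lemma count_near_cover (F : set X) (J : set nat) (t rho a : R) :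
  0 < t -> separated F t -> t <= rho -> 2 * rho <= D -> 0 <= a ->
  (forall xi, F xi -> psi (rad xi) <= t / 2) ->
  (forall i, J i -> v i `^ s^-1 <= rho) ->
  (\esum_(xi in F) \esum_(i in J `&` meets (ball xi (psi (rad xi))))
      (Num.min (v i) a)%:E
   <= (K2 * (1 + a * rho `^ (alpha - s) / t `^ alpha))%:E *
      \esum_(i in J) (v i)%:E)%E.
Proof.
move=> t0 Fsep trho rhoD a0 Fpsi Jrho.
have w0 i : 0 <= Num.min (v i) a by rewrite le_min a0 ltW.
pose e i := v i `^ s^-1.
have e0 i : 0 < e i by rewrite powR_gt0.
pose N i := K2 * (1 + e i `^ alpha / t `^ alpha).
apply: le_trans (le_esum_double_count (N := N)
   (rel := fun xi i => meets (ball xi (psi (rad xi))) i) _ _) _ => //.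
  move=> i Ji; set P := (F `&` _).
  have [[xi0 [Fxi0 [u [Uu _]]]]|P0] := pselect (P !=set0); last first.
    rewrite esum1; last by move=> xi Pxi; exfalso; apply: P0; exists xi.
    by rewrite lee_fin /N mulr_ge0 ?(ltW K2_gt0)// addr_ge0// divr_ge0 ?powR_ge0.
  have ei := Jrho _ Ji; have ei0 := e0 i; rewrite -/(e i) in ei.
  have Hr : 0 <= e i + t / 2 by lra.
  have Hrt : (e i + t / 2) + t / 2 <= D by lra.
  apply: le_trans (packing (y := u) Cm_gt0 mu_ball Hr t0 Hrt _ _) _.
  - move=> xi [Fxi [w [Uw]]]; rewrite ballEmdist/= => xiw.
    have := U_diam Uu Uw; rewrite -/(e i) => uw.
    have := metric_triangle u w xi; have := Fpsi _ Fxi.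
    by rewrite (metric_sym w xi); lra.
  - by move=> x z [Fx _] [Fz _]; exact: Fsep.
  rewrite lee_fin /N /K2 -mulrA ler_pM2l ?exprn_gt0//.
  apply: le_trans (_ : (4 * Num.max 1 (e i / t)) `^ alpha <= _).
    apply: ge0_ler_powR; first exact: ltW.
    - by rewrite nnegrE divr_ge0 ?(ltW t0)//; lra.
    - by rewrite nnegrE mulr_ge0// le_max ler01.
    rewrite ler_pdivrMr//; have [et|et] := leP (e i) t.
      rewrite max_l ?ler_pdivrMr ?mul1r//; lra.
    rewrite max_r ?ler_pdivlMr ?mul1r ?(ltW et)//.
    by rewrite -mulrA divfK ?gt_eqF//; lra.
  rewrite powRM// ?le_max ?ler01// ler_pM2l ?powR_gt0//.
  have [et|et] := leP 1 (e i / t); last by rewrite powR1 lerDl divr_ge0 ?powR_ge0.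
  by rewrite powR_div ?(ltW ei0) ?(ltW t0)// lerDr.
apply: le_trans (esumZl_le _ _ _); last 2 first.
- rewrite mulr_ge0 ?(ltW K2_gt0)// addr_ge0// divr_ge0 ?mulr_ge0 ?powR_ge0//.
- by move=> i; rewrite lee_fin ltW.
apply: le_esum => i Ji; rewrite -EFinM lee_fin /N mulrCA.
rewrite -(mulrA K2 _ (v i)) ler_pM2l//.
rewrite mulrDr mulr1 mulrDl mul1r; apply: lerD; first by rewrite ge_min lexx.
have eE : e i `^ alpha = e i `^ (alpha - s) * v i.
  have -> : v i = e i `^ s by rewrite /e -powRrM mulVf ?gt_eqF// powRr1// ltW.
  by rewrite -powRD ?subrK// [e i == 0]gt_eqF ?implybT.
rewrite eE (_ : a * _ / _ * v i = a * (rho `^ (alpha - s) * v i / t `^ alpha)); last by ring.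
apply: ler_pM => //; first by rewrite !mulr_ge0 ?powR_ge0 ?invr_ge0 ?powR_ge0// ltW.
  by rewrite ge_min lexx orbT.
rewrite ler_pM2r ?invr_gt0 ?powR_gt0// ler_pM2r//.
apply: ge0_ler_powR; rewrite ?nnegrE ?subr_ge0 ?(ltW s_lt) ?(ltW (e0 i))//.
  exact: le_trans (ltW t0) trho.
exact: Jrho.
Qed.

(** A single weight is at most the whole [load], and [kappa <= 1] turns the bound on the weight into
    one on the size. *)
Lemma cover_radius_le (y : X) (rho : R) (i : nat) : 0 < rho ->
  (load (ball y rho) <= (kappa * rho `^ s)%:E)%E -> meets (ball y rho) i ->
  v i <= kappa * rho `^ s /\ v i `^ s^-1 <= rho.
Proof.
move=> rho0 Hload Ji; have vi : v i <= kappa * rho `^ s.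
  rewrite -lee_fin; apply: le_trans Hload; rewrite /load.
  rewrite -[leLHS](@esum_set1 _ _ i (fun i => (v i)%:E)); last by rewrite lee_fin ltW.
  by apply: le_esum_set => _ ->.
split => //; rewrite -[leRHS](powRr1 (ltW rho0)) -(mulfV (lt0r_neq0 s_gt0)) powRrM.
apply: ge0_ler_powR; rewrite ?invr_ge0 ?nnegrE ?powR_ge0 ?(ltW s_gt0) ?(ltW (v_gt0 i))//.
by apply: le_trans vi _; rewrite ler_piMl ?powR_ge0// ge_min lexx.
Qed.

(* The first alternative excludes centers whose ball meets that of another
   point of [Q], the second those whose ball meets too much of the cover; if
   every center of [F] failed one of them, the two double counts would give
   [#|F| <= 3/4 * c * (rho / t) `^ alpha]. *)
Lemma exists_good_center (F : set X) (y : X) (rho sigma t a : R) :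
  0 < t -> separated F t -> t <= rho -> 2 * rho <= D -> 3 * sigma <= D ->
  (forall r, 0 < r -> r <= sigma -> psi r <= r) -> 0 < a ->
  (forall xi, F xi -> psi (rad xi) <= t / 2) ->
  ((c * (rho `^ alpha / t `^ alpha))%:E <= \esum_(xi in F) (1 : \bar R))%E ->
  (load (ball y rho) <= (kappa * rho `^ s)%:E)%E ->
  (K1%:E * small_sum sigma <= (c / 4 * rho `^ alpha)%:E)%E ->
  K2 * kappa * rho `^ s <= c / 4 * (rho `^ alpha / t `^ alpha) * a ->
  exists xi, [/\ F xi,
    forall zeta, Q zeta -> rad zeta <= sigma -> t <= 2 * psi (rad zeta) ->
      2 * psi (rad zeta) <= mdist zeta xi &
    (\esum_(i in meets (ball y rho) `&` meets (ball xi (psi (rad xi))))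
       (Num.min (v i) a)%:E < a%:E)%E].
Proof.
move=> t0 Fsep trho rhoD sD psi_le a0 Fpsi Fcard Hload Hsmall Ha.
apply: contrapT => H; move: Fcard; apply/negP; rewrite -ltNge.
have rho0 := lt_le_trans t0 trho.
have ta0 : 0 < t `^ alpha by rewrite powR_gt0.
have ra0 : 0 < rho `^ alpha by rewrite powR_gt0.
set L := rho `^ alpha / t `^ alpha in Ha *.
have L0 : 0 < L by rewrite divr_gt0.
have w0 i : 0 <= Num.min (v i) a by rewrite le_min !ltW.
pose a1 xi := (\esum_(zeta in (Q `&` [set zeta | (rad zeta <= sigma)%R]) `&`
      [set zeta | (t <= 2 * psi (rad zeta) /\ mdist zeta xi < 2 * psi (rad zeta))%R])
    (1%R)%:E : \bar R)%E.
pose a2 xi := (\esum_(i in meets (ball y rho) `&` meets (ball xi (psi (rad xi))))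
      (Num.min (v i) a)%:E)%E.
have a10 xi : (0 <= a1 xi)%E by apply: esum_ge0 => ? _; rewrite lee_fin.
have a20 xi : (0 <= a2 xi)%E by apply: esum_ge0 => ? _; rewrite lee_fin.
(* Every center is spoiled, so [a1 xi >= 1] or [a2 xi >= a]; this is Markov's inequality in summed
   form. *)
have le1 : (\esum_(xi in F) (1 : \bar R) <= \esum_(xi in F) (a1 xi + a^-1%:E * a2 xi))%E.
  apply: le_esum => xi Fxi.
  have [H1|/existsNP[zeta /not_implyP[Qz /not_implyP[zs /not_implyP[tz]]]]] := pselect
    (forall zeta, Q zeta -> rad zeta <= sigma -> t <= 2 * psi (rad zeta) ->
      2 * psi (rad zeta) <= mdist zeta xi).
    have : (a%:E <= a2 xi)%E.
      by rewrite leNgt; apply/negP => H2; apply: H; exists xi.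
    move=> /(lee_wpmul2l (_ : 0 <= a^-1%:E)%E); rewrite lee_fin invr_ge0 ltW//.
    move=> /(_ isT); rewrite -EFinM mulVf ?gt_eqF// => /le_trans; apply.
    by rewrite leeDr.
  move=> /negP; rewrite -ltNge => zxi.
  have : (1 <= a1 xi)%E.
    rewrite -[leLHS](@esum_set1 _ _ zeta (fun=> (1%R)%:E)) ?lee_fin//.
    by apply: le_esum_set => _ ->.
  by move=> /le_trans; apply; rewrite leeDl// mule_ge0// lee_fin invr_ge0 ltW.
apply: le_lt_trans le1 _; rewrite esumD//; last first.
  by move=> xi _; rewrite mule_ge0// lee_fin invr_ge0 ltW.
have le2 : (\esum_(xi in F) a1 xi <= (c / 4 * L)%:E)%E.
  apply: le_trans (count_near_centers t0 Fsep sD psi_le) _.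
  rewrite (_ : K1 / _ = (t `^ alpha)^-1 * K1); last by rewrite mulrC.
  rewrite EFinM -muleA; apply: (@le_trans _ _ ((t `^ alpha)^-1%:E * (c / 4 * rho `^ alpha)%:E)%E).
    by apply: lee_wpmul2l => //; rewrite lee_fin invr_ge0 ltW.
  by rewrite -EFinM lee_fin /L le_eqVlt; apply/orP; left; apply/eqP; ring.
(* Of the two quarters, the first is the hypothesis [Ha] on [a], the second the choice of
   [kappa]. *)
have le3 : (\esum_(xi in F) (a^-1%:E * a2 xi) <= (2 * (c / 4 * L))%:E)%E.
  have Jrho i : meets (ball y rho) i -> v i `^ s^-1 <= rho.
    by move=> Ji; have [] := cover_radius_le rho0 Hload Ji.
  apply: le_trans (esumZl_le _ _ _) _; rewrite ?invr_ge0 ?(ltW a0)//.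
  have B0 : 0 <= K2 * (1 + a * rho `^ (alpha - s) / t `^ alpha).
    rewrite mulr_ge0 ?(ltW K2_gt0)// addr_ge0// divr_ge0 ?mulr_ge0 ?powR_ge0//.
    exact: ltW.
  apply: (@le_trans _ _ (a^-1%:E * ((K2 * (1 + a * rho `^ (alpha - s) / t `^ alpha))%:E *
     (kappa * rho `^ s)%:E))%E).
    apply: lee_wpmul2l; first by rewrite lee_fin invr_ge0 ltW.
    apply: le_trans (count_near_cover t0 Fsep trho rhoD (ltW a0) Fpsi Jrho) _.
    by apply: lee_wpmul2l => //; rewrite lee_fin.
  rewrite -!EFinM lee_fin.
  have rE : rho `^ alpha = rho `^ (alpha - s) * rho `^ s.
    by rewrite -powRD ?subrK// [rho == 0]gt_eqF ?implybT.
  have kK : K2 * kappa <= c / 4.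
    rewrite mulrC -ler_pdivlMr// (_ : c / 4 / K2 = c / (4 * K2)); last by rewrite -mulrA -invfM.
    by rewrite ge_min lexx orbT.
  rewrite (_ : a^-1 * _ = K2 * kappa * rho `^ s / a + K2 * kappa * L); last first.
    by rewrite /L rE; field; rewrite !gt_eqF.
  rewrite mulr2n mulrDl mul1r; apply: lerD; first by rewrite ler_pdivrMr.
  by rewrite ler_pM2r.
apply: le_lt_trans (leeD le2 le3) _; rewrite -EFinD lte_fin.
have : 0 < c * L by rewrite mulr_gt0.
lra.
Qed.

(** For [rad xi <= sigma] one has [psi (rad xi) <= sigma * (psi (rad xi) / rad xi)], so
    [small_sum sigma] is controlled by a tail of the convergent series. *)
Lemma small_sum_tail (e : R) : 0 < e ->
  exists2 h, 0 < h & forall sigma, 0 < sigma -> sigma <= h ->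
    (small_sum sigma <= (e * sigma `^ alpha)%:E)%E.
Proof.
move=> e0.
have f0 xi : (0 <= ((psi (rad xi) / rad xi) `^ alpha)%:E)%E.
  by rewrite lee_fin powR_ge0.
have [h h0 hP] := esum_tail (fun xi _ => f0 xi) rad_gt0 psi_series e0.
exists h => // sigma s0 sh; rewrite mulrC EFinM.
apply: le_trans (lee_wpmul2l _ hP); last by rewrite lee_fin powR_ge0.
apply: (@le_trans _ _ (\esum_(xi in Q `&` [set xi | (rad xi <= sigma)%R])
    ((sigma `^ alpha)%:E * ((psi (rad xi) / rad xi) `^ alpha)%:E))%E).
  apply: le_esum => xi [Qxi /= xis]; rewrite -EFinM lee_fin.
  have r0 := rad_gt0 Qxi; have p0 := psi_gt0 r0.
  rewrite -powRM ?(ltW s0) ?divr_ge0 ?(ltW p0) ?(ltW r0)//.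
  apply: ge0_ler_powR; rewrite ?nnegrE ?(ltW alpha_gt0) ?(ltW p0)//.
    by rewrite mulr_ge0 ?divr_ge0 ?ltW.
  by rewrite mulrCA ler_pMr// ler_pdivlMr// mul1r.
apply: le_trans (esumZl_le _ _ _) _; rewrite ?powR_ge0//.
apply: lee_wpmul2l; first by rewrite lee_fin powR_ge0.
by apply: le_esum_set => xi [Qxi /= xis]; split => //=; exact: le_trans sh.
Qed.

(** * Admissible balls and the inductive step *)

Context (psi_large : forall M e : R, 0 < e ->
  exists x, [/\ 0 < x, x < e & M * x `^ alpha <= psi x `^ s]).
Context (sigma0 : R) (sigma0_gt0 : 0 < sigma0) (sigma0_le : 3 * sigma0 <= D).
Context (psi_le : forall r, 0 < r -> r <= sigma0 -> psi r <= r).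

(* The bound on [load] excludes all [U i] of diameter larger than [rho]; the
   bound on [small_sum] makes the balls around points of [Q] with radius at most
   [sigma] cover only a small part of the ball. *)
Definition admissible (y : X) (rho sigma : R) : Prop :=
  [/\ 0 < rho, 2 * rho <= D, 0 < sigma <= sigma0,
      (load (ball y rho) <= (kappa * rho `^ s)%:E)%E &
      (K1%:E * small_sum sigma <= (c / 4 * rho `^ alpha)%:E)%E].

(* A point [zeta] with [rad zeta <= rad xi] too close to [xi] has radius at most
   [2 * C * psi (rad xi)] by separation, and is left to the following steps. *)
Lemma admissible_centers (y : X) (rho sigma delta m : R) :
  admissible y rho sigma -> 0 < delta -> 0 < m ->
  exists (xi : X) (a : R), [/\ Q xi, rad xi <= m,
    ball xi (rad xi) `<=` ball y rho &
    [/\ 0 < a <= kappa * (delta * psi (rad xi) / 4) `^ s,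
    forall zeta, Q zeta -> zeta <> xi -> rad zeta <= sigma ->
      2 * C * psi (rad xi) < rad zeta ->
      psi (rad zeta) + psi (rad xi) <= mdist zeta xi &
    (\esum_(i in meets (ball y rho) `&` meets (ball xi (psi (rad xi))))
       (Num.min (v i) a)%:E < a%:E)%E]].
Proof.
move=> [rho0 rhoD /andP[sg0 sgle] Hload Hsmall] delta0 m0.
(* Chosen so that [rad xi <= C / k%:R] gives [psi (rad xi) <= t / 2] for the separation [t]
   introduced below. *)
pose e' := (2 * C ^+ 3)^-1.
have e'0 : 0 < e' by rewrite invr_gt0 mulr_gt0// exprn_gt0.
have [h2 h20 h2P] := psi_littleo e'0.
have rhoD1 : rho <= D by lra.
have [k0 k0P] := well_distributed_points y rho0 rhoD1.
have [h3 h30 h3P] := exists_scale k0 C_ge1.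
pose m1 := Num.min (Num.min m h2) (Num.min rho sigma0).
have m10 : 0 < m1 by rewrite !lt_min m0 h20 rho0.
(* Solves for the size of [psi x] that [Ha] below requires, given [t <= 2 * x]. *)
pose N := 4 * K2 * rho `^ s * 2 `^ alpha / (c * rho `^ alpha * (delta / 4) `^ s).
have h0 : 0 < Num.min h3 (m1 / (2 * C ^+ 2)).
  by rewrite lt_min h30 divr_gt0// mulr_gt0// exprn_gt0.
have [x [x0' + Nx]] := psi_large N h0; rewrite lt_min => /andP[/ltW xh3 xm1].
have [k [k0k kpos xk kx]] := h3P _ x0' xh3.
have kr0 : 0 < k%:R :> R by rewrite ltr0n.
have [F [FQ Frad Fball Fcard]] := k0P _ k0k.
(* Points of [F] have radius at least [(C * k%:R)^-1], and separation loses one more factor [C]. *)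
pose t := (C ^+ 2 * k%:R)^-1.
have t0 : 0 < t by rewrite invr_gt0 mulr_gt0// exprn_gt0.
have Ckm1 : C / k%:R <= m1.
  apply: le_trans (_ : C * (2 * C * x) <= _); first by rewrite ler_pM2l.
  move: xm1; rewrite ltr_pdivlMr ?mulr_gt0 ?exprn_gt0// => /ltW; apply: le_trans.
  by rewrite le_eqVlt; apply/orP; left; apply/eqP; ring.
have [km kh2 krho ks] : [/\ C / k%:R <= m, C / k%:R <= h2, C / k%:R <= rho & C / k%:R <= sigma0].
  by move: Ckm1; rewrite !le_min => /andP[/andP[-> ->] /andP[-> ->]].
have tk : t <= k%:R^-1.
  by rewrite lef_pV2 ?posrE ?mulr_gt0 ?exprn_gt0// ler_peMl ?(ltW kr0)// exprn_ege1.
have trho : t <= rho.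
  apply: le_trans tk (le_trans _ krho).
  by rewrite ler_peMl ?invr_ge0 ?(ltW kr0).
have t2x : t <= 2 * x.
  rewrite /t invfM mulrC ler_pdivrMr ?exprn_gt0//; apply: le_trans kx _.
  rewrite -mulrA (mulrC C) mulrA ler_pM2l ?mulr_gt0//.
  by rewrite expr2 ler_peMl// ltW.
have tE : C^-1 * (C * k%:R)^-1 = t by rewrite /t; field; rewrite !gt_eqF.
have Fsep : separated F t.
  move=> xi zeta Fxi Fzeta xz.
  apply: le_trans (Q_sep (FQ _ Fxi) (FQ _ Fzeta) xz).
  rewrite -tE ler_pM2l ?invr_gt0// le_min.
  by have /andP[-> _] := Frad _ Fxi; have /andP[-> _] := Frad _ Fzeta.
have Fpsi xi : F xi -> psi (rad xi) <= t / 2.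
  move=> Fxi; have /andP[_ xiC] := Frad _ Fxi; have r0 := rad_gt0 (FQ _ Fxi).
  apply: le_trans (h2P _ r0 (le_trans xiC kh2)) _.
  apply: le_trans (_ : e' * (C / k%:R) <= _); first by rewrite ler_pM2l.
  by rewrite /e' /t le_eqVlt; apply/orP; left; apply/eqP; field; rewrite !gt_eqF.
have rhos0 : 0 < delta * psi x / 4 by rewrite divr_gt0// mulr_gt0// psi_gt0.
(* As [xi] is not yet chosen, [a] is defined from [psi x]; [x <= rad xi] and monotonicity of [psi]
   give the bound in terms of [xi] afterwards. *)
pose a := kappa * (delta * psi x / 4) `^ s.
have a0 : 0 < a by rewrite mulr_gt0// powR_gt0.
have sD : 3 * sigma <= D by move: sigma0_le; lra.
have psi_le' r : 0 < r -> r <= sigma -> psi r <= r.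
  by move=> r0 rs; apply: psi_le => //; exact: le_trans sgle.
have tA : t `^ alpha = ((C ^+ 2) `^ alpha)^-1 * (k%:R `^ alpha)^-1.
  rewrite /t -powR_inv1 ?mulr_ge0 ?exprn_ge0 ?ltW// -powRrM mulN1r powRN.
  by rewrite powRM ?exprn_ge0 ?(ltW C_gt0) ?(ltW kr0)// invfM.
have Fcard' : ((c * (rho `^ alpha / t `^ alpha))%:E <= \esum_(xi in F) (1 : \bar R))%E.
  apply: le_trans Fcard; rewrite lee_fin le_eqVlt; apply/orP; left; apply/eqP.
  rewrite tA /c powRN; field.
  by rewrite !gt_eqF// ?powR_gt0// exprn_gt0.
have Ha : K2 * kappa * rho `^ s <= c / 4 * (rho `^ alpha / t `^ alpha) * a.
  rewrite /a (_ : c / 4 * _ * _ = kappa * (c / 4 * rho `^ alpha * (delta * psi x / 4) `^ s) / t `^ alpha); last by ring.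
  rewrite ler_pdivlMr ?powR_gt0// (_ : K2 * kappa * _ * _ = kappa * (K2 * rho `^ s * t `^ alpha)); last by ring.
  rewrite ler_pM2l// (_ : delta * psi x / 4 = delta / 4 * psi x); last by ring.
  have p0 := psi_gt0 x0'.
  rewrite powRM ?divr_ge0 ?(ltW delta0) ?(ltW p0)//.
  have d4 : 0 < (delta / 4) `^ s by rewrite powR_gt0// divr_gt0.
  have ra : 0 < rho `^ alpha by rewrite powR_gt0.
  have cra : 0 < c / 4 * rho `^ alpha by apply: mulr_gt0 ra; rewrite divr_gt0.
  apply: (@le_trans _ _ (c / 4 * rho `^ alpha * ((delta / 4) `^ s * (N * x `^ alpha)))); last first.
    by rewrite ler_pM2l// ler_pM2l.
  rewrite (_ : c / 4 * _ * _ = K2 * rho `^ s * (2 `^ alpha * x `^ alpha)); last first.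
    by rewrite /N; field; rewrite !gt_eqF.
  rewrite ler_pM2l ?mulr_gt0 ?powR_gt0// -powRM ?(ltW x0')//.
  apply: ge0_ler_powR; rewrite ?nnegrE ?(ltW alpha_gt0) ?(ltW t0)//.
  by rewrite mulr_ge0// ltW.
have [xi [Fxi xi_far xi_light]] := exists_good_center t0 Fsep trho rhoD sD psi_le' a0
  Fpsi Fcard' Hload Hsmall Ha.
have Qxi := FQ _ Fxi; have r0 := rad_gt0 Qxi; have p0 := psi_gt0 r0.
have /andP[rad_ge rad_le] := Frad _ Fxi.
exists xi, a; split => //; first exact: le_trans km.
  exact: Fball.
split => //.
- rewrite a0 /a; apply: ler_wpM2l; first exact: ltW.
  apply: ge0_ler_powR; rewrite ?nnegrE ?(ltW s_gt0) ?(ltW rhos0)//.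
    by rewrite divr_ge0// mulr_ge0 ?ltW.
  apply: ler_wpM2r; first by [].
  apply: ler_wpM2l; first exact: ltW.
  apply: psi_ndecr => //.
  exact: le_trans xk rad_ge.
move=> zeta Qz zxi zs zgt; have rz0 := rad_gt0 Qz.
have sep := Q_sep Qz Qxi zxi.
rewrite leNgt; apply/negP => near.
have [zr|rz] := leP (rad zeta) (rad xi).
  have := psi_ndecr rz0 zr; move: sep; rewrite min_l// ler_pdivrMl//.
  move=> sep pp; move: zgt; apply/negP; rewrite -leNgt; apply: le_trans sep _.
  rewrite -[leRHS]mulrA (mulrCA 2) ler_pM2l//; lra.
(* Here separation puts [zeta] at distance at least [t]. Being too close then forces
   [t <= 2 * psi (rad zeta)], a case excluded by the choice of [xi]. *)
have := psi_ndecr r0 (ltW rz); move: sep; rewrite min_r ?(ltW rz)// => sep pp.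
have tz : t <= mdist zeta xi.
  by apply: le_trans sep; rewrite -tE ler_pM2l ?invr_gt0.
have : t <= 2 * psi (rad zeta) by lra.
by move=> /(xi_far _ Qz zs); lra.
Qed.

(** With [p = psi (rad xi)], the new center is taken in the annulus about [xi] between
    [(1 - delta) * p] and [(1 - delta / 2) * p], and [rho' = delta * p / 4] keeps the new ball
    between [(1 - 2 * delta) * p] and [p]. With [sigma' = 2 * C * p], points of radius above
    [sigma'] are dealt with now and smaller ones later. *)
Lemma admissible_step (y : X) (rho sigma delta eta : R) :
  admissible y rho sigma -> 0 < delta -> delta <= 1 / 2 -> 0 < eta ->
  exists (xi : X) (y' : X) (rho' sigma' : R),
  [/\ Q xi, rad xi <= eta, admissible y' rho' sigma', rho' <= eta & sigma' <= eta] /\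
  [/\ cball y' rho' `<=` ball y rho,
      forall z, cball y' rho' z ->
        (1 - 2 * delta) * psi (rad xi) <= mdist z xi < psi (rad xi) &
      forall z zeta, cball y' rho' z -> Q zeta -> zeta <> xi ->
        sigma' < rad zeta <= sigma -> psi (rad zeta) <= mdist z zeta].
Proof.
move=> adm delta0 delta1 eta0; have [rho0 rhoD /andP[sg0 sgle] Hload Hsmall] := adm.
(* Makes [small_sum sigma'] fit the budget of the radius [rho']. Both scale with [p], which cancels,
   so [e0] can be fixed before [xi]. *)
pose e0 := c / 4 * (delta / 4) `^ alpha / (K1 * (2 * C) `^ alpha).
have C20 : 0 < 2 * C by rewrite mulr_gt0.
have d4 : 0 < delta / 4 by rewrite divr_gt0.
have c4 : 0 < c / 4 by rewrite divr_gt0.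
have e00 : 0 < e0.
  by apply: divr_gt0; apply: mulr_gt0 => //; rewrite powR_gt0.
have [h1 h10 h1P] := small_sum_tail e00.
pose m1 := Num.min (Num.min eta sigma) h1.
have m10 : 0 < m1 by rewrite !lt_min eta0 sg0.
pose m := Num.min (m1 / (2 * C)) (Num.min eta sigma0).
have m0 : 0 < m by rewrite !lt_min eta0 sigma0_gt0 divr_gt0.
have [xi [a [Qxi xim xiB [/andP[a0 aP] far light]]]] := admissible_centers adm delta0 m0.
have r0 := rad_gt0 Qxi; have p0 := psi_gt0 r0.
have [xim1 xieta xis0] : [/\ rad xi <= m1 / (2 * C), rad xi <= eta & rad xi <= sigma0].
  by move: xim; rewrite !le_min => /and3P[].
have pr := psi_le r0 xis0.
set p := psi (rad xi) in p0 pr aP far light *.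
pose sigma' := 2 * C * p.
have sg0' : 0 < sigma' by rewrite mulr_gt0.
have sgm1 : sigma' <= m1.
  by rewrite /sigma' mulrC -ler_pdivlMr//; exact: le_trans xim1.
have [sgeta sgs sgh] : [/\ sigma' <= eta, sigma' <= sigma & sigma' <= h1].
  by move: sgm1; rewrite !le_min => /andP[/andP[]].
pose rho' := delta * p / 4.
have rho0' : 0 < rho' by rewrite divr_gt0// mulr_gt0.
have dp : delta * p <= p / 2.
  by rewrite (_ : p / 2 = 1 / 2 * p) ?ler_pM2r//; ring.
have dp0 : 0 < delta * p by rewrite mulr_gt0.
have rhoE : rho' = delta * p / 4 by [].
have r10 : 0 < (1 - delta) * p by rewrite mulr_gt0//; lra.
have r12 : (1 - delta) * p < (1 - delta / 2) * p by rewrite ltr_pM2r//; lra.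
have r2D : (1 - delta / 2) * p <= D by move: sigma0_le; lra.
have [y' /andP[y'1 y'2]] := annulus_neq0 xi r10 r12 r2D.
have ball_xi z : cball y' rho' z -> mdist z xi < p.
  rewrite /cball/= => zy'; have := metric_triangle xi y' z.
  by rewrite (metric_sym xi z); lra.
have ball_y : ball xi p `<=` ball y rho.
  by apply: subset_trans xiB; exact: le_ball.
exists xi, y', rho', sigma'; split; split => //.
- split => //.
  + by move: sigma0_le; lra.
  + by rewrite sg0' (le_trans sgs).
  + have sub : meets (ball y' rho') `<=` meets (ball y rho) `&` meets (ball xi p).
      move=> i [z [Uz]]; rewrite ballEmdist/= => /ltW/ball_xi.
      rewrite metric_sym => zxi; split; exists z; split => //.
        by apply: ball_y; rewrite ballEmdist.
      by rewrite ballEmdist.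
    apply: le_trans (_ : (a%:E <= _)%E); last by rewrite lee_fin.
    apply: le_trans (ltW light); apply: le_trans (le_esum_set _ sub) _.
    (* A set with [v i > a] would by itself bring the truncated sum to [a]; hence the truncation is
       inactive and the sum bounds the true load. *)
    apply: le_esum => i Ji; rewrite lee_fin le_min lexx/= leNgt; apply/negP => av.
    move: light; apply/negP; rewrite -leNgt.
    have m_ge0 : 0 <= Num.min (v i) a by rewrite le_min !ltW.
    rewrite -[a in leLHS](min_r (ltW av)) -[leLHS](@esum_set1 _ _ i (fun i => (Num.min (v i) a)%:E)) ?lee_fin//.
    by apply: le_esum_set => _ ->.
  + apply: le_trans (lee_wpmul2l _ (h1P _ sg0' sgh)) _; first by rewrite lee_fin ltW.
    rewrite -EFinM lee_fin /sigma' /rho' (@powRM _ (2 * C) p) ?(ltW C20) ?(ltW p0)//.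
    rewrite (_ : delta * p / 4 = delta / 4 * p); last by ring.
    rewrite (@powRM _ (delta / 4) p) ?(ltW d4) ?(ltW p0)// /e0 le_eqVlt; apply/orP; left; apply/eqP.
    have := powR_gt0 alpha C20; set w := (2 * C) `^ alpha => w0.
    by field; rewrite !gt_eqF.
- by rewrite rhoE; lra.
- move=> z /ball_xi; rewrite metric_sym => zxi; apply: ball_y.
  by rewrite ballEmdist.
- move=> z zy'; rewrite ball_xi// andbT; move: zy'; rewrite /cball/= => zy'.
  have := metric_triangle xi z y'; rewrite (metric_sym xi z) (metric_sym z y').
  rewrite -/p; lra.
- move=> z zeta zy' Qz zxi /andP[z1 z2].
  have := far _ Qz zxi z2 z1; have := ball_xi _ zy'.
  have := metric_triangle zeta z xi; rewrite (metric_sym zeta z); lra.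
Qed.

(** The step is iterated from the ball of radius [D / 2] with [delta] tending to 0. The points
    [xi n] put the limit in the limsup set; every other point of [Q] with radius below [sg] is
    avoided at the step whose range of radii contains it. *)
Lemma Eset_point_outside_cover :
  (\esum_(i in [set: nat]) (v i)%:E <= (kappa * (D / 2) `^ s)%:E)%E ->
  exists2 x, Eset psi Q rad x & forall i, ~ U i x.
Proof.
move=> v_le.
have D20 : 0 < D / 2 by rewrite divr_gt0.
have [sg [sg0 adm0]] : exists sg, 0 < sg /\ admissible x0 (D / 2) sg.
  have DA : 0 < c / 4 * (D / 2) `^ alpha.
    have c40 : 0 < c / 4 by rewrite divr_gt0.
    by apply: mulr_gt0 c40 _; rewrite powR_gt0.
  have sA : 0 < K1 * sigma0 `^ alpha by apply: mulr_gt0 => //; rewrite powR_gt0.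
  have [h h0 hP] := small_sum_tail (divr_gt0 DA sA).
  exists (Num.min h sigma0); split; first by rewrite lt_min h0.
  have hs0 : 0 < Num.min h sigma0 by rewrite lt_min h0.
  have hs1 : Num.min h sigma0 <= h by rewrite ge_min lexx.
  have hs2 : Num.min h sigma0 <= sigma0 by rewrite ge_min lexx orbT.
  split => //; first by rewrite mulrC divfK.
  - by rewrite hs0.
    by apply: le_trans v_le; exact: le_esum_set.
  apply: le_trans (lee_wpmul2l _ (hP _ hs0 hs1)) _; first by rewrite lee_fin ltW.
  rewrite -EFinM lee_fin.
  apply: (@le_trans _ _ (K1 * (c / 4 * (D / 2) `^ alpha / (K1 * sigma0 `^ alpha) * sigma0 `^ alpha))).
    apply: ler_wpM2l; first exact: ltW.
    apply: ler_wpM2l; first by rewrite ltW// divr_gt0.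
    by apply: ge0_ler_powR; rewrite ?nnegrE ?(ltW alpha_gt0) ?(ltW hs0) ?(ltW sigma0_gt0).
  have := powR_gt0 alpha sigma0_gt0; set w := sigma0 `^ alpha => w0.
  by rewrite le_eqVlt; apply/orP; left; apply/eqP; field; rewrite !gt_eqF.
pose St := ((X * R) * R)%type.
pose adm (st : St) := admissible st.1.1 st.1.2 st.2.
(* The shift by 2 gives [d n <= 1 / 2] already at [n = 0]. *)
pose d (n : nat) : R := n.+2%:R^-1.
pose e (n : nat) : R := n.+1%:R^-1.
have d0 n : 0 < d n by rewrite invr_gt0 ltr0n.
have d1 n : d n <= 1 / 2 by rewrite div1r lef_pV2 ?posrE ?ltr0n// ler_nat.
have e0 n : 0 < e n by rewrite invr_gt0 ltr0n.
pose rel (n : nat) (st : St) (xi : X) (st' : St) :=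
  [/\ Q xi, rad xi <= e n, adm st', st'.1.2 <= e n & st'.2 <= e n] /\
  [/\ cball st'.1.1 st'.1.2 `<=` ball st.1.1 st.1.2,
      forall z, cball st'.1.1 st'.1.2 z ->
        (1 - 2 * d n) * psi (rad xi) <= mdist z xi < psi (rad xi) &
      forall z zeta, cball st'.1.1 st'.1.2 z -> Q zeta -> zeta <> xi ->
        st'.2 < rad zeta <= st.2 -> psi (rad zeta) <= mdist z zeta].
have /choice[step stepP] : forall p : nat * St, exists q : X * St,
    adm p.2 -> rel p.1 p.2 q.1 q.2.
  move=> [n st]; have [admst|nadm] := pselect (adm st); last by exists (x0, st).
  have [xi [y' [rho' [sigma' H]]]] := admissible_step admst (d0 n) (d1 n) (e0 n).
  by exists (xi, (y', rho', sigma')).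
pose st := fix st n := if n is m.+1 then (step (m, st m)).2 else ((x0, D / 2), sg).
pose xi n := (step (n, st n)).1.
have admn n : adm (st n).
  by elim: n => [//|n IH]; have [[]] := stepP (n, st n) IH.
have relP n : rel n (st n) (xi n) (st n.+1) := stepP (n, st n) (admn n).
have e_cvg (a : R) : 0 < a -> exists n, e n < a.
  move=> a0; exists (Num.truncn a^-1); rewrite -[ltRHS]invrK ltf_pV2 ?posrE ?ltr0n ?invr_gt0//.
  exact: truncnS_gt.
have rho0 n : 0 < (st n).1.2 by have [] := admn n.
have rho_cvg (a : R) : 0 < a -> exists n, (st n).1.2 < a.
  move=> /e_cvg[n en]; exists n.+1; apply: le_lt_trans en.
  by have [[_ _ _ ? _] _] := relP n.
have nest n : cball (st n.+1).1.1 (st n.+1).1.2 `<=` ball (st n).1.1 (st n).1.2.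
  by have [_ []] := relP n.
have [x xP] := nested_balls_limit rho_cvg rho0 nest.
have xball n : ball (st n).1.1 (st n).1.2 x by exact/nest/xP.
exists x; last first.
  (* At such a small radius [v i] alone exceeds the load allowed on the ball, so [U i] cannot meet
     it. *)
  move=> i Uix; have [|n rn] := rho_cvg ((v i / kappa) `^ s^-1).
    by rewrite powR_gt0// divr_gt0.
  have [_ _ _ Hload _] := admn n.
  have meet_i : meets (ball (st n).1.1 (st n).1.2) i by exists x.
  have [vi _] := cover_radius_le (rho0 n) Hload meet_i.
  move: rn; apply/negP; rewrite -leNgt.
  rewrite -[leRHS](powRr1 (ltW (rho0 n))) -(mulfV (lt0r_neq0 s_gt0)) powRrM.
  apply: ge0_ler_powR; rewrite ?invr_ge0 ?nnegrE ?powR_ge0 ?(ltW s_gt0)//.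
    by rewrite ltW// divr_gt0.
  by rewrite ler_pdivrMr// mulrC.
have xxi n : (1 - 2 * d n) * psi (rad (xi n)) <= mdist x (xi n) < psi (rad (xi n)).
  by have [_ [_ H _]] := relP n; exact: H.
split.
  move=> finW; have [h h0 hP] := finite_set_lbound finW (fun z Hz => rad_gt0 Hz.1).
  have [n en] := e_cvg _ h0; have [[Qxi rn _ _ _] _] := relP n.
  have : h < rad (xi n) by apply: hP; split => //; have /andP[] := xxi n.
  by rewrite ltNge (le_trans rn)// ltW.
move=> [c' /= /andP[c0' c1]]; apply.
(* From index [N] on, [1 - 2 * d n >= c'], so [xi n] no longer approximates [x] to within
   [c' * psi]. *)
pose N := Num.truncn (2 / (1 - c')).
apply: (@sub_finite_set _ _ ((Q `&` [set zeta | sg <= rad zeta]) `|`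
    (xi @` `I_N))); last first.
  by rewrite finite_setU; split; [exact: finite_rad_ge|exact: finite_image].
move=> zeta [Qz zx]; have r0 := rad_gt0 Qz; have p0 := psi_gt0 r0.
have [zs|zs] := leP sg (rad zeta); [by left|right].
have ex : exists n, (st n).2 < rad zeta.
  have [n en] := e_cvg _ r0; exists n.+1; apply: le_lt_trans en.
  by have [[_ _ _ _ ?] _] := relP n.
(* The least index with [sigma] below [rad zeta] singles out the step [n] at which [zeta] was either
   avoided or chosen as [xi n]. *)
have [[|n] nP nmin] := ex_minnP ex; first by move: nP; rewrite ltNge ltW.
have zn : rad zeta <= (st n).2 by rewrite leNgt; apply/negP => /nmin; rewrite ltnn.
have [zE|zxi] := pselect (zeta = xi n); last first.
  exfalso; have [_ [_ _ H]] := relP n.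
  have : psi (rad zeta) <= mdist x zeta by apply: H => //; rewrite nP zn.
  rewrite leNgt (lt_trans zx)//.
  by rewrite gtr_pMl.
exists n => //=; have /andP[+ _] := xxi n; rewrite -zE => H.
have : (1 - 2 * d n) * psi (rad zeta) < c' * psi (rad zeta) by exact: le_lt_trans zx.
rewrite ltr_pM2r// => H2.
have n2 : n.+2%:R < 2 / (1 - c').
  rewrite ltr_pdivlMr ?subr_gt0// mulrC -ltr_pdivlMr ?ltr0n// -/(d n); lra.
have : (n.+1 <= N)%N.
  rewrite truncn_ge_nat; last by rewrite divr_ge0// subr_ge0 ltW.
  by rewrite (le_trans _ (ltW n2))// ler_nat.
done.
Qed.

End cover.

Lemma Eset_hausdorff_measure_neq0 (s : R) : 0 < s -> s < alpha ->
  (forall N e : R, 0 < e -> exists x, [/\ 0 < x, x < e & N * x `^ alpha <= psi x `^ s]) ->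
  hausdorff_measure s (Eset psi Q rad) <> 0%E.
Proof.
move=> s0 sa psi_large.
have D20 : 0 < D / 2 by rewrite divr_gt0.
have eta0 : 0 < kappa * (D / 2) `^ s / 2.
  by apply: divr_gt0 => //; apply: mulr_gt0 => //; rewrite powR_gt0.
apply: (hausdorff_measure_neq0 eta0) => U Ufin Usum EU.
set eta := _ / 2 in eta0 Usum.
pose b i := fine (diam (U i)) `^ s.
(* The added term makes the weight positive even for sets of diameter 0; in total it costs [eta],
   the other half of the load allowed initially. *)
pose v i := b i + eta / (2 ^ i.+1)%:R.
have w0 (i : nat) : 0 < eta / (2 ^ i.+1)%:R by rewrite divr_gt0// ltr0n expn_gt0.
have v0 i : 0 < v i by rewrite ltr_wpDl// powR_ge0.
have Uv i x z : U i x -> U i z -> mdist x z <= v i `^ s^-1.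
  move=> Ux Uz; have f0 : 0 <= fine (diam (U i)) by rewrite fine_ge0// diam_ge0.
  apply: le_trans (_ : fine (diam (U i)) <= _).
    by rewrite -lee_fin fineK//; exact: mdist_le_diam.
  rewrite -[leLHS](powRr1 f0) -(mulfV (lt0r_neq0 s0)) powRrM.
  apply: ge0_ler_powR; rewrite ?invr_ge0 ?nnegrE ?powR_ge0 ?(ltW s0) ?(ltW (v0 i))//.
  by rewrite lerDl ltW.
have [h h0 hP] := psi_littleo ltr01.
pose sigma0 := Num.min h (D / 3).
have sigma00 : 0 < sigma0 by rewrite lt_min h0 divr_gt0.
have sigma0D : 3 * sigma0 <= D by rewrite mulrC -ler_pdivlMr// ge_min lexx orbT.
have psi_le r : 0 < r -> r <= sigma0 -> psi r <= r.
  by move=> r0; rewrite le_min => /andP[rh _]; have := hP _ r0 rh; rewrite mul1r.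
have [|x Ex Ux] := Eset_point_outside_cover s0 sa v0 Uv psi_large sigma00 sigma0D psi_le.
  rewrite -nneseries_esumT; last by move=> i; rewrite lee_fin ltW.
  rewrite (eq_eseriesr (g := fun i => (diam (U i) `^ s + (eta / (2 ^ i.+1)%:R)%:E)%E)); last first.
    by move=> i _; rewrite EFinD -poweR_EFin fineK.
  apply: le_trans (epsilon_trick _ _ _) _; rewrite ?(ltW eta0)//.
    by move=> i; exact: poweR_ge0.
  apply: le_trans (leeD (ltW Usum) (lexx _)) _.
  by rewrite -EFinD lee_fin /eta -splitr.
by have [i _] := EU x Ex; exact: Ux.
Qed.

End approximation_setting.

(** * The lower order *)

Section lower_order_bounds.
Context {R : realType} (psi : R -> R).
Context (psi_gt0 : forall x : R, 0 < x -> 0 < psi x).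

Lemma near_right_interval (e : R) : 0 < e -> (0^'+ : set_system R) [set t : R | 0 < t < e].
Proof.
move=> e0; near=> t => /=; apply/andP; split; near: t.
  exact: nbhs_right_gt.
exact: nbhs_right_lt.
Unshelve. all: by end_near. Qed.

Lemma right_nbhs_interval (V : set R) : (0^'+ : set_system R) V ->
  exists2 e : R, 0 < e & forall t, 0 < t -> t < e -> V t.
Proof.
move=> /nbhs_ballP[e /= e0 eV]; exists e => // t t0 te.
by apply: eV => //; rewrite -ball_normE /= sub0r normrN gtr0_norm.
Qed.

Lemma lt_lower_order (a : R) : (a%:E < lower_order psi)%E ->
  exists2 e : R, 0 < e & forall t, 0 < t -> t < e -> psi t <= t `^ a.
Proof.
rewrite /lower_order limf_einfE => /ereal_sup_gt[_ [V V0 <-] aV].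
have [e e0 eV] := right_nbhs_interval V0.
(* Below 1 the logarithm is negative, so clearing the denominator reverses the inequality. *)
exists (Num.min e 1); first by rewrite lt_min e0 ltr01.
move=> t t0; rewrite lt_min => /andP[te t1].
have : (a%:E < (ln (psi t) / ln t)%:E)%E.
  by apply: lt_le_trans aV _; apply: ereal_inf_lbound; exists t => //; exact: eV.
have lnt : ln t < 0 by rewrite ln_lt0// t0.
rewrite lte_fin ltr_ndivlMr// => /ltW H.
rewrite -[leLHS](lnK (psi_gt0 t0)) /powR gt_eqF//.
by rewrite ler_expR.
Qed.

Lemma lower_order_lt (b : R) : (lower_order psi < b%:E)%E ->
  forall e : R, 0 < e -> exists t, [/\ 0 < t, t < e & t `^ b <= psi t].
Proof.
move=> + e e0; rewrite /lower_order limf_einfE => psib.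
have e10 : 0 < Num.min e 1 by rewrite lt_min e0 ltr01.
have : (ereal_inf ((fun x => (ln (psi x) / ln x)%:E) @` [set t | (0 < t < Num.min e 1)%R]) < b%:E)%E.
  apply: le_lt_trans psib; apply: ereal_sup_ubound.
  by exists [set t | 0 < t < Num.min e 1] => //; exact: near_right_interval.
move=> /ereal_inf_lt[_ [t /= /andP[t0 +] <-]]; rewrite lt_min => /andP[te t1].
have lnt : ln t < 0 by rewrite ln_lt0// t0.
rewrite lte_fin ltr_ndivrMr// => /ltW H; exists t; split => //.
rewrite -[leRHS](lnK (psi_gt0 t0)) /powR gt_eqF//.
by rewrite ler_expR.
Qed.

(** Keeps the lower order away from 0 and from negative values, so that dividing [alpha] by it
    behaves as expected. *)
Lemma lower_order_ge1 : (exists2 h : R, 0 < h & forall t, 0 < t -> t <= h -> psi t <= t) ->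
  (1 <= lower_order psi)%E.
Proof.
move=> [h h0 hP]; rewrite leNgt; apply/negP => lt1.
have : exists b : R, b < 1 /\ (lower_order psi < b%:E)%E.
  move: lt1; case: (lower_order psi) => [l| |] //.
    rewrite lte_fin => l1; exists ((l + 1) / 2); rewrite lte_fin; split; lra.
  by move=> _; exists 0; rewrite ltNyr.
move=> [b [b1 /lower_order_lt lb]].
have m0 : 0 < Num.min h 1 by rewrite lt_min h0 ltr01.
have [t [t0 + tb]] := lb _ m0; rewrite lt_min => /andP[/ltW th t1].
move: (le_trans tb (hP _ t0 th)); apply/negP; rewrite -ltNge.
have lnt : ln t < 0 by rewrite ln_lt0// t0.
rewrite /powR gt_eqF// -[ltLHS](lnK t0) ltr_expR.
by rewrite ltr_nMl.
Qed.

End lower_order_bounds.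

(** * Assembling the dimension formula *)

(** In a one-point space, well-distribution would force [rad x0 <= C / k%:R] for all large [k],
    against [rad x0 > 0]. *)
Lemma exists_distinct (R : realType) (X : completeMetricType R)
    (mu : {measure set (g_sigma_algebraType (@open X)) -> \bar R})
    (alpha C : R) (Q : set X) (rad : X -> R) :
  1 <= C -> (0 < mu [set: X])%E -> (forall xi, Q xi -> 0 < rad xi) ->
  well_distributed mu alpha Q rad C -> forall x0 : X, exists x1 : X, x1 != x0.
Proof.
move=> C1 mu0 rad_gt0 Q_dist x0; apply: contrapT => H.
have C0 : 0 < C by exact: lt_le_trans C1.
have allx x : x = x0 by apply: contrapT => /eqP xx0; apply: H; exists x.
have ballT : ball x0 1 = [set: X].
  by apply/seteqP; split => // x _; rewrite (allx x); exact: ballxx.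
have [k0 k0P] := Q_dist x0 1 ltr01.
have Qk k : (k0 <= k)%N -> (0 < k)%N -> Q x0 /\ rad x0 <= C / k%:R.
  move=> /k0P[F [FQ Frad _ Fcard]] kpos.
  have [[xi Fxi]|F0] := pselect (F !=set0).
    by move: (FQ _ Fxi) (Frad _ Fxi); rewrite (allx xi) => ? /andP[].
  have : ((C^-1 * k%:R `^ alpha)%:E * mu (ball x0 1 : set X) <= 0)%E.
    apply: le_trans Fcard (le_trans (counting_le_esum _) _).
    by rewrite esum1// => i Fi; exfalso; apply: F0; exists i.
  rewrite leNgt ballT mule_gt0// lte_fin mulr_gt0 ?invr_gt0// powR_gt0// ltr0n//.
have [Qx0 _] := Qk k0.+1 (leqnSn _) isT; have r0 := rad_gt0 _ Qx0.
pose k := maxn k0 (Num.truncn (C / rad x0)).+1.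
have kpos : (0 < k)%N by rewrite leq_max orbT.
have [_] := Qk k (leq_maxl _ _) kpos; apply/negP; rewrite -ltNge.
rewrite ltr_pdivrMr ?ltr0n// mulrC -ltr_pdivrMr//.
by apply: lt_le_trans (truncnS_gt _) _; rewrite ler_nat leq_maxr.
Qed.

Theorem theorem0p2 (R : realType) (X : completeMetricType R)
    (mu : {measure set (g_sigma_algebraType (@open X)) -> \bar R})
    (alpha beta : R) (Q : set X) (rad : X -> R) (psi : R -> R)
    (alpha_gt0 : 0 < alpha) (beta_gt0 : 0 < beta)
    (mu_gt0 : (0 < mu [set: X])%E)
    (mu_regular : ab_regular mu alpha beta)
    (Q_countable : countable Q)
    (rad_gt0 : forall xi, Q xi -> 0 < rad xi)
    (rad_bounded : exists M : R, forall xi, Q xi -> rad xi <= M)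
    (Q_WDS : WDS mu alpha Q rad)
    (psi_gt0 : forall x : R, 0 < x -> 0 < psi x)
    (psi_ndecr : forall x y : R, 0 < x -> x <= y -> psi x <= psi y)
    (psi_series :
      (\esum_(xi in Q) ((psi (rad xi) / rad xi) `^ alpha)%:E < +oo)%E) :
  hausdorff_dim (Eset psi Q rad) = hausdorff_dim (Wset psi Q rad) /\
  hausdorff_dim (Wset psi Q rad) = (alpha%:E / lower_order psi)%E.
Proof.
have [Cm [Cm_gt0 mu_ahlfors mu_annular]] := mu_regular.
have [C [C_ge1 Q_sep Q_dist]] := Q_WDS.
have [M rad_leM] := rad_bounded.
have C_gt0 : 0 < C by exact: lt_le_trans C_ge1.
have [x0 _] : [set: X] !=set0.
  apply/set0P/eqP => X0; move: mu_gt0; rewrite X0.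
  by rewrite measure0 ltxx.
have [x1 x01] := exists_distinct C_ge1 mu_gt0 rad_gt0 Q_dist x0.
(* A positive real lower bound of the diameter, available even when the diameter is infinite. *)
pose D := mdist x1 x0.
have D_gt0 : 0 < D by rewrite mdist_gt0.
have D_diam (r : R) : r <= D -> (r%:E <= diam [set: X])%E.
  move=> rD; apply: le_trans (_ : (D%:E <= _)%E); last exact: mdist_le_diam.
  by rewrite lee_fin.
have mu_ball (x : X) (r : R) : 0 < r -> r <= D ->
    ((r `^ alpha / Cm)%:E <= mu (ball x r : set X) <= (Cm * r `^ alpha)%:E)%E.
  by move=> r0 /D_diam; apply: mu_ahlfors; exact: ltW.
(* Annular regularity enters as nonemptiness: its lower bound is positive when [r1 < r2]. *)
have annulus_neq0 (x : X) (r1 r2 : R) : 0 < r1 -> r1 < r2 -> r2 <= D ->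
    exists y, r1 <= mdist x y <= r2.
  move=> r10 r12 r2D; apply: contrapT => H.
  have : (mu (annulus x r1 r2 : set X) = 0)%E.
    rewrite (_ : annulus x r1 r2 = set0) ?measure0//.
    rewrite -subset0 => y [y2]; rewrite ballEmdist/= => /negP; rewrite -leNgt => y1.
    by apply: H; exists y; rewrite y1.
  have := mu_annular x r1 r2 r10 (ltW r12) (D_diam _ r2D) => + mu0.
  rewrite mu0 lee_fin leNgt => /negP; apply.
  apply: mulr_gt0; first by rewrite mulr_gt0 ?invr_gt0 ?powR_gt0.
  by rewrite powR_gt0// divr_gt0// subr_gt0.
have psi_le : exists2 h : R, 0 < h & forall t, 0 < t -> t <= h -> psi t <= t.
  have [h h0 hP] := psi_littleo alpha_gt0 Cm_gt0 D_gt0 C_ge1 mu_ball rad_gt0 Q_dist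
    psi_gt0 psi_ndecr psi_series x0 ltr01.
  by exists h => // t t0 th; rewrite -[leRHS]mul1r hP.
have lam1 := lower_order_ge1 psi_gt0 psi_le.
have dimEW : (hausdorff_dim (Eset psi Q rad) <= hausdorff_dim (Wset psi Q rad))%E.
  by apply: le_hausdorff_dim => x [].
suff [dimW dimE] : (hausdorff_dim (Wset psi Q rad) <= alpha%:E / lower_order psi)%E /\
    (alpha%:E / lower_order psi <= hausdorff_dim (Eset psi Q rad))%E.
  have dEq : hausdorff_dim (Eset psi Q rad) = hausdorff_dim (Wset psi Q rad).
    by apply/eqP; rewrite eq_le dimEW (le_trans dimW).
  by split => //; apply/eqP; rewrite eq_le dimW -dEq.
have dim_le (s : R) : 0 < s -> ((alpha / s)%:E < lower_order psi)%E ->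
    (hausdorff_dim (Wset psi Q rad) <= s%:E)%E.
  move=> s0 lam; apply: ereal_inf_lbound; exists s => //; split => //.
  have [b [sb lb]] : exists b : R, alpha / s < b /\ (b%:E < lower_order psi)%E.
    move: lam; case: (lower_order psi) => [l| |] //; last first.
      by move=> _; exists (alpha / s + 1); rewrite ltrDl ltr01 ltry.
    rewrite lte_fin => l1; exists ((alpha / s + l) / 2); rewrite lte_fin; split; lra.
  have [e e0 eP] := lt_lower_order psi_gt0 lb.
  apply: (Wset_hausdorff_measure0 alpha_gt0 Cm_gt0 D_gt0 C_ge1 mu_ball Q_countable rad_gt0
    rad_leM Q_sep Q_dist psi_gt0 psi_ndecr psi_series x0 s0).
  exists (b * s), e; split => //; first by rewrite -ltr_pdivrMr.
  move=> t t0 te; rewrite powRrM.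
  by apply: ge0_ler_powR; rewrite ?nnegrE ?powR_ge0 ?(ltW s0) ?(ltW (psi_gt0 _ t0)) ?eP.
have dim_ge (s : R) : 0 < s -> (lower_order psi < (alpha / s)%:E)%E ->
    hausdorff_measure s (Eset psi Q rad) <> 0%E.
  move=> s0 lam.
  have [b [sb lb]] : exists b : R, b < alpha / s /\ (lower_order psi < b%:E)%E.
    move: lam lam1; case: (lower_order psi) => [l| |] //.
    rewrite lte_fin => l1 _; exists ((alpha / s + l) / 2); rewrite lte_fin; split; lra.
  (* Since the lower order is at least 1, [s <= s * b < alpha]. *)
  have b1 : 1 < b by rewrite -lte_fin (le_lt_trans lam1).
  have sba : s * b < alpha by rewrite mulrC -ltr_pdivlMr.
  have sa : s < alpha by rewrite (le_lt_trans _ sba)// ler_pMr// ltW.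
  have d0 : 0 < alpha - s * b by rewrite subr_gt0.
  have large (N e : R) : 0 < e ->
      exists x, [/\ 0 < x, x < e & N * x `^ alpha <= psi x `^ s].
    (* [N'] is a positive replacement for [N]; for [t] small, the spare power [alpha - s * b] of [t]
       absorbs it. *)
    move=> e0; pose N' := Num.max N 1.
    have N'0 : 0 < N' by rewrite lt_max ltr01 orbT.
    have m0 : 0 < Num.min e (N'^-1 `^ (alpha - s * b)^-1).
      by rewrite lt_min e0 powR_gt0// invr_gt0.
    have [t [t0 + tb]] := lower_order_lt psi_gt0 lb m0.
    rewrite lt_min => /andP[te /ltW tN]; exists t; split => //.
    apply: (@le_trans _ _ (t `^ (s * b))); last first.
      rewrite mulrC powRrM; apply: ge0_ler_powR; rewrite ?nnegrE ?powR_ge0 ?(ltW s0)//.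
      exact: ltW (psi_gt0 _ t0).
    rewrite (_ : alpha = (alpha - s * b) + s * b); last by rewrite subrK.
    rewrite powRD; last by rewrite [t == 0]gt_eqF ?implybT.
    rewrite mulrA ler_piMl ?powR_ge0//.
    apply: (@le_trans _ _ (N' * t `^ (alpha - s * b))).
      by apply: ler_wpM2r; rewrite ?powR_ge0// le_max lexx.
    rewrite -ler_pdivlMl// mulr1 -[leRHS](powRr1 (_ : 0 <= N'^-1)) ?invr_ge0 ?(ltW N'0)//.
    rewrite -(mulVf (lt0r_neq0 d0)) powRrM.
    by apply: ge0_ler_powR; rewrite ?nnegrE ?powR_ge0 ?(ltW d0) ?(ltW t0).
  exact: (Eset_hausdorff_measure_neq0 alpha_gt0 Cm_gt0 D_gt0 C_ge1 mu_ball annulus_neq0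
    rad_gt0 rad_leM Q_sep Q_dist psi_gt0 psi_ndecr psi_series x0 s0 sa large).
split.
  apply/lee_addgt0Pr => e e0; move: lam1 dim_le; case: (lower_order psi) => [l| |] //.
    rewrite lee_fin => l1 dim_le; have l0 : 0 < l by exact: lt_le_trans l1.
    rewrite inver gt_eqF// -EFinM -EFinD; apply: dim_le.
      by rewrite addr_gt0// divr_gt0.
    rewrite lte_fin ltr_pdivrMr ?addr_gt0 ?divr_gt0// mulrDr mulrC divfK ?gt_eqF//.
    by rewrite ltrDl mulr_gt0.
  (* For infinite lower order the quotient is 0, and every [e > 0] bounds the dimension. *)
  by move=> _ dim_le; rewrite invey mule0 add0e dim_le// ltry.
apply: le_ereal_inf_tmp => _ [s [s0 sE] <-]; rewrite leNgt; apply/negP => lts.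
apply: (dim_ge s s0) sE; move: lam1 lts; case: (lower_order psi) => [l| |] //.
  rewrite lee_fin => l1; have l0 : 0 < l by exact: lt_le_trans l1.
  by rewrite inver gt_eqF// -EFinM !lte_fin ltr_pdivlMr// mulrC -ltr_pdivlMr.
by move=> _; rewrite invey mule0 lte_fin ltNge ltW.
Qed.
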